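(* Let $R=k[x_1,\ldots,x_n]$ be a polynomial ring over a field $k$ with homogeneous maximal ideal $\mathfrak m=(x_1,\ldots,x_n)$. Let $1\le a_1\le\cdots\le a_r$ be integers and let $M=\mathfrak m^{a_1}\oplus\cdots\oplus\mathfrak m^{a_r}$. Then the Rees algebra $\mathcal R(M)$ and the special fiber ring $\mathcal F(M)$ are Koszul normal domains. Furthermore, $\mathcal R(M)=S/I_2(C)$ and $\mathcal F(M)=T/I_2(B)$; that is, with $\phi:S\to\mathcal R(M)$ and $\psi:T\to\mathcal F(M)$ the epimorphisms given in the context, $\ker\phi=I_2(C)$ and $\ker\psi=I_2(B)$.
   Context: For an integer $a\ge 1$ let $\mathcal J_a$ be the set of multi-indices $\underline j=(j_{n-1},\ldots,j_1)$ of integers with $0\le j_1\le\cdots\le j_{n-1}\le a$, and let $\mathcal J'_a$ be the subset of those with $1\le j_1$. For $\underline j\in\mathcal J_a$ put $\underline x^{a,\underline j}=\prod_{i=1}^n x_i^{j_i-j_{i-1}}$, where $j_0=0$ and $j_n=a$ (these are the monomials of degree $a$). The Rees algebra of $M$ is the subalgebra $\mathcal R(M)=R[\{\underline x^{a_l,\underline j}t_l : 1\le l\le r,\ \underline j\in\mathcal J_{a_l}\}]$ of the polynomial ring $R[t_1,\ldots,t_r]$, and the special fiber ring is its subalgebra $\mathcal F(M)=k[\{\underline x^{a_l,\underline j}t_l : 1\le l\le r,\ \underline j\in\mathcal J_{a_l}\}]$ (isomorphic to $\mathcal R(M)/\mathfrak m\mathcal R(M)$). Let $T=k[T_{l,\underline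 j} : 1\le l\le r,\ \underline j\in\mathcal J_{a_l}]$ and $S=T[x_1,\ldots,x_n]$ be polynomial rings. Let $\phi:S\to\mathcal R(M)$ be the $R$-algebra epimorphism with $\phi(T_{l,\underline j})=\underline x^{a_l,\underline j}t_l$, and let $\psi:T\to\mathcal F(M)$ be its restriction to $T$. For $1\le l\le r$, $\underline j\in\mathcal J'_{a_l}$ and $1\le s\le n$, let $T_{l,\underline j,s}$ denote the variable $T_{l,(j_{n-1},\ldots,j_s,\,j_{s-1}-1,\ldots,j_1-1)}$ (so $T_{l,\underline j,1}=T_{l,\underline j}$). Let $B$ be the matrix with $n$ rows, with columns indexed by the pairs $(l,\underline j)$, $1\le l\le r$, $\underline j\in\mathcal J'_{a_l}$, ordered lexicographically, whose entry in row $s$ and column $(l,\underline j)$ is $T_{l,\underline j,s}$. Let $C$ be the matrix obtained from $B$ by adjoining as first column $(x_1,\ldots,x_n)^{\rm tr}$. $I_2(\cdot)$ denotes the ideal generated by the $2\times 2$ minors (in $S$ for $C$, in $T$ for $B$). Koszulness refers to the standard grading over $k$ in which the images of all the variables $x_i$ and $T_{l,\underline j}$ have degree one. *)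

(* Defs.v *)
From HB Require Import structures.
From mathcomp Require Import all_boot all_order all_algebra.
From mathcomp Require Import boolp.
From mathcomp Require Import mpoly.

Set Implicit Arguments.
Unset Strict Implicit.
Unset Printing Implicit Defensive.

Import Order.TTheory GRing.Theory.
Local Open Scope ring_scope.

Section GeneratedSubalgebra.

Variables (B D : comNzRingType).
Variables (iota : {rmorphism B -> D}) (G : D -> Prop).

Inductive subalg_gen : D -> Prop :=
| SubalgBase b : subalg_gen (iota b)
| SubalgGen x of G x : subalg_gen x
| SubalgAdd x y of subalg_gen x & subalg_gen y : subalg_gen (x + y)
| SubalgMul x y of subalg_gen x & subalg_gen y : subalg_gen (x * y).

Definition subalg_pred : {pred D} := [pred x | `[< subalg_gen x >]].

Lemma subalg_predP x : reflect (subalg_gen x) (x \in subalg_pred).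
Proof. by rewrite inE; apply: asboolP. Qed.

Fact subalg_subring_closed : subring_closed subalg_pred.
Proof.
split=> [|x y /subalg_predP Sx /subalg_predP Sy
         |x y /subalg_predP Sx /subalg_predP Sy]; apply/subalg_predP.
- by rewrite -(rmorph1 iota); apply: SubalgBase.
- apply: SubalgAdd => //; rewrite -mulN1r -(rmorph1 iota) -rmorphN.
  by apply: SubalgMul => //; apply: SubalgBase.
- exact: SubalgMul.
Qed.

(* The B-subalgebra B[G] of D, as a ring in its own right.                    *)
Record subalg : predArgType :=
  Subalg { subalg_val : D; _ : subalg_val \in subalg_pred }.

HB.instance Definition _ := [isSub for subalg_val].
HB.instance Definition _ := [Choice of subalg by <:].
HB.instance Definition _ :=
  GRing.SubChoice_isSubComNzRing.Build D subalg_pred subalg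
    subalg_subring_closed.

Definition subalg_unit : {pred subalg} :=
  [pred x : subalg | `[< exists y, y * x = 1 >]].

Definition subalg_inv (x : subalg) : subalg :=
  if pselect (exists y, y * x = 1) is left ex_inv then projT1 (cid ex_inv)
  else x.

Fact subalg_mulVx : {in subalg_unit, left_inverse 1 subalg_inv *%R}.
Proof.
move=> x /asboolP Ux; rewrite /subalg_inv; case: pselect => // ex_inv.
by case: cid.
Qed.

Fact subalg_unitPl (x y : subalg) : y * x = 1 -> subalg_unit x.
Proof. by move=> yx1; apply/asboolP; exists y. Qed.

Fact subalg_invr_out : {in [predC subalg_unit], subalg_inv =1 id}.
Proof. by move=> x /asboolP; rewrite /subalg_inv; case: pselect. Qed.

HB.instance Definition _ :=
  GRing.ComNzRing_hasMulInverse.Build subalg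
    subalg_mulVx subalg_unitPl subalg_invr_out.

Fact subalg_integral :
  GRing.integral_domain_axiom D -> GRing.integral_domain_axiom subalg.
Proof.
move=> D_int x y /(congr1 val); rewrite rmorphM rmorph0 => /D_int.
by rewrite -!(inj_eq val_inj) rmorph0.
Qed.

Definition subalg_elt x (Gx : G x) : subalg :=
  Subalg (introT (subalg_predP x) (SubalgGen Gx)).

Definition subalg_base (b : B) : subalg :=
  Subalg (introT (subalg_predP (iota b)) (SubalgBase b)).

Fact subalg_base_zmod_morphism : zmod_morphism subalg_base.
Proof. by move=> x y; apply: val_inj; rewrite /= !rmorphB. Qed.

Fact subalg_base_monoid_morphism : monoid_morphism subalg_base.
Proof.
by split=> [|x y]; apply: val_inj; rewrite /= ?rmorphM ?rmorph1.
Qed.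

HB.instance Definition _ :=
  GRing.isZmodMorphism.Build B subalg subalg_base subalg_base_zmod_morphism.
HB.instance Definition _ :=
  GRing.isMonoidMorphism.Build B subalg subalg_base
    subalg_base_monoid_morphism.

End GeneratedSubalgebra.

(* That A has no zero divisors is part of its type.                           *)
Definition normal_domain (A : idomainType) : Prop :=
  forall z : {fraction A},
    integralOver (@FracField.tofrac A) z -> exists x : A, z = FracField.tofrac x.

Section Ideals.

Variable A : comNzRingType.

Definition ideal_gen (G : A -> Prop) (x : A) : Prop :=
  exists (m : nat) (c g : 'I_m -> A),
    (forall i, G (g i)) /\ x = \sum_(i < m) c i * g i.

Definition is_minor (t m p : nat) (X : 'M[A]_(m, p)) (x : A) : Prop :=
  exists (f : 'I_t -> 'I_m) (g : 'I_t -> 'I_p),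
    [/\ {homo f : u v / (u < v)%N}, {homo g : u v / (u < v)%N}
      & x = \det (mxsub f g X)].

Definition minors_ideal (t m p : nat) (X : 'M[A]_(m, p)) : A -> Prop :=
  ideal_gen (is_minor t X).

End Ideals.

(* A k-algebra A (structure map iota) generated by a finite family g, graded  *)
(* so that every g i has degree one.                                          *)
Section Koszul.

Variables (k : fieldType) (A : comNzRingType) (iota : {rmorphism k -> A}).
Variables (I : finType) (g : I -> A).

(* A_d is the k-span of the products of d generators; in particular A_0 is    *)
(* the image of k.                                                            *)
Definition std_comp (d : nat) (x : A) : Prop :=
  exists c : {ffun 'I_d -> I} -> k,
    x = \sum_(w : {ffun 'I_d -> I}) iota (c w) * \prod_(i < d) g (w i).

Definition std_graded : Prop :=
  (forall x : A, exists (m : nat) (f : nat -> A),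
      (forall d, std_comp d (f d)) /\ x = \sum_(d < m) f d)
  /\
  (forall (m : nat) (f : nat -> A),
      (forall d, std_comp d (f d)) -> \sum_(d < m) f d = 0 ->
      forall d, (d < m)%N -> f d = 0).

(* The ideal A_+ = A_1 + A_2 + ...                                            *)
Definition irrelevant (x : A) : Prop :=
  exists (m : nat) (f : nat -> A),
    (forall d, std_comp d.+1 (f d)) /\ x = \sum_(d < m) f d.

(* Ranks of the free modules F_0 = A, F_1 = A^(b 0), F_2 = A^(b 1), ...       *)
Definition res_rank (b : nat -> nat) (i : nat) : nat :=
  if i is i'.+1 then b i' else 1%N.

(* The residue field A/A_+ has a linear free resolution                       *)
(*   ... -> F_2 --D 1--> F_1 --D 0--> F_0 = A -> A/A_+ -> 0,                  *)
(* elements of F_i being row vectors, on which D i acts on the right; the     *)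
(* entries of all the D i lie in A_1.                                         *)
Definition has_linear_resolution : Prop :=
  exists (b : nat -> nat)
         (D : forall i, 'M[A]_(res_rank b i.+1, res_rank b i)),
    [/\ forall i p q, std_comp 1 (D i p q),
        forall x : A, irrelevant x <-> exists v, v *m D 0%N = x%:M
      & forall i (u : 'rV[A]_(res_rank b i.+1)),
          u *m D i = 0 <-> exists v, u = v *m D i.+1].

Definition koszul : Prop := std_graded /\ has_linear_resolution.

End Koszul.

(* mindex n a is the set J_a. A multi-index is stored in increasing order     *)
(* j_1 <= ... <= j_(n-1); ji j s is j_s, with j_0 = 0 and j_n = a.            *)
Section MultiIndex.

Variables n a : nat.

Record mindex : predArgType := MIndex {
  mindex_val : n.-1.-tuple 'I_a.+1;
  _ : sorted leq (map val mindex_val)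
}.

HB.instance Definition _ := [isSub for mindex_val].
HB.instance Definition _ := [Finite of mindex by <:].

Definition ji (j : mindex) (s : nat) : nat :=
  nth a (0%N :: map val (val j)) s.

(* (j_(n-1), ..., j_s, j_(s-1) - 1, ..., j_1 - 1), meant for 1 <= j_1; the    *)
(* entry j_(i+1) is at position i, and is lowered when i + 1 < s.             *)
Definition lower_tuple (j : mindex) (s : nat) : n.-1.-tuple 'I_a.+1 :=
  [tuple inord (tnth (val j) i - (i.+1 < s)) | i < n.-1].

Fact lower_sorted j s : sorted leq (map val (lower_tuple j s)).
Proof.
have tnE i (lt_i : (i < n.-1)%N) :
    nth 0%N (map val (lower_tuple j s)) i
    = (nth 0%N (map val (val j)) i - (i.+1 < s))%N.
  rewrite !(nth_map ord0) ?size_tuple //.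
  have := tnth_nth ord0 (lower_tuple j s) (Ordinal lt_i).
  rewrite /= tnth_mktuple => <-; rewrite inordK; first by rewrite (tnth_nth ord0).
  by rewrite ltnS (leq_trans (leq_subr _ _)) // -ltnS ltn_ord.
apply/(sortedP 0%N) => i; rewrite size_map size_tuple => lt_i.
rewrite !tnE ?(ltnW lt_i) //.
apply: leq_sub; last by case: ltnP => // /ltnW->.
move: (valP j) => /(sortedP 0%N); apply.
by rewrite size_map size_tuple.
Qed.

Definition lower (j : mindex) (s : nat) : mindex := MIndex (lower_sorted j s).

End MultiIndex.

Fact mpoly_rmorph_eq (n : nat) (B A : comNzRingType)
    (f g : {rmorphism {mpoly B[n]} -> A}) :
  (forall c, f c%:MP = g c%:MP) -> (forall i, f 'X_i = g 'X_i) -> f =1 g.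
Proof.
move=> eqC eqX p; rewrite [p]mpolyE !rmorph_sum; apply: eq_bigr => m _.
rewrite -mul_mpolyC !rmorphM eqC mpolyXE_id !rmorph_prod; congr (_ * _).
by apply: eq_bigr => i _; rewrite !rmorphXn eqX.
Qed.

Section ColumnIndex.

Variables (n r : nat) (a : 'I_r -> nat).

(* Pairs (l, j) with j in J_(a_l).                                            *)
Definition colidx := {l : 'I_r & mindex n (a l)}.

Definition cj (c : colidx) (s : nat) : nat := ji (tagged c) s.

Definition clower (c : colidx) (s : nat) : colidx :=
  Tagged (fun l => mindex n (a l)) (lower (tagged c) s).

End ColumnIndex.

(* The rings T = k[T_(l,j)] and S = T[x_1, ..., x_n].                         *)
Notation Tpoly k n a := {mpoly k[#|{: colidx n a}|]} (only parsing).
Notation Spoly k n a := {mpoly (Tpoly k n a)[n]} (only parsing).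

Section ReesAlgebra.

Variables (k : fieldType) (n r : nat) (a : 'I_r -> nat).

Local Notation R := {mpoly k[n]}.
Local Notation Rt := {mpoly R[r]}.
Local Notation colidx := (colidx n a).
Local Notation T := (Tpoly k n a).
Local Notation S := (Spoly k n a).

(* x_1, ..., x_n are 'X_0, ..., 'X_(n-1), hence the exponent of 'X_i.         *)
Definition xmon (c : colidx) : R :=
  \prod_(i < n) 'X_i ^+ (cj c i.+1 - cj c i).

Definition xt (c : colidx) : Rt := (xmon c)%:MP * 'X_(tag c).

Definition is_xt (f : Rt) : Prop := exists c : colidx, f = xt c.

Fact is_xt_xt c : is_xt (xt c). Proof. by exists c. Qed.

Fact Rt_integral : GRing.integral_domain_axiom Rt.
Proof. exact: mpoly_idomainAxiom. Qed.

Definition rees : predArgType :=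
  subalg (@mpolyC r R) is_xt.
HB.instance Definition _ := GRing.ComUnitRing.on rees.
HB.instance Definition _ :=
  GRing.ComUnitRing_isIntegral.Build rees (subalg_integral Rt_integral).

Definition k_to_Rt : k -> Rt := @mpolyC r R \o @mpolyC n k.
HB.instance Definition _ := GRing.RMorphism.on k_to_Rt.

Definition fiber : predArgType := subalg k_to_Rt is_xt.
HB.instance Definition _ := GRing.ComUnitRing.on fiber.
HB.instance Definition _ :=
  GRing.ComUnitRing_isIntegral.Build fiber (subalg_integral Rt_integral).

Definition R_to_rees : R -> rees := @subalg_base _ _ (@mpolyC r R) is_xt.
HB.instance Definition _ := GRing.RMorphism.on R_to_rees.

Definition k_to_rees : k -> rees := R_to_rees \o @mpolyC n k.
HB.instance Definition _ := GRing.RMorphism.on k_to_rees.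

Definition k_to_fiber : k -> fiber := @subalg_base _ _ k_to_Rt is_xt.
HB.instance Definition _ := GRing.RMorphism.on k_to_fiber.

Definition rees_xt (c : colidx) : rees := subalg_elt _ (is_xt_xt c).
Definition fiber_xt (c : colidx) : fiber := subalg_elt _ (is_xt_xt c).

Definition rees_gens (v : 'I_n + colidx) : rees :=
  match v with inl i => R_to_rees 'X_i | inr c => rees_xt c end.

Definition Tvar (c : colidx) : T := 'X_(enum_rank c).

Definition psi : T -> fiber :=
  mmap k_to_fiber (fun v => fiber_xt (enum_val v)).
HB.instance Definition _ := GRing.RMorphism.on psi.

Definition phi : S -> rees :=
  mmap (mmap k_to_rees (fun v => rees_xt (enum_val v)))
       (fun i => R_to_rees 'X_i).
HB.instance Definition _ := GRing.RMorphism.on phi.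

Fact phi_X i : phi 'X_i = R_to_rees 'X_i.
Proof. by rewrite /phi mmapX mmap1U. Qed.

Fact phi_T c : phi (Tvar c)%:MP = rees_xt c.
Proof. by rewrite /phi mmapC /= mmapX mmap1U enum_rankK. Qed.

Fact psi_T c : psi (Tvar c) = fiber_xt c.
Proof. by rewrite /psi mmapX mmap1U enum_rankK. Qed.

Fact phi_R (f : R) : phi (map_mpoly (@mpolyC #|{: colidx}| k) f) = R_to_rees f.
Proof.
pose g : {rmorphism R -> rees} := phi \o map_mpoly (@mpolyC #|{: colidx}| k).
apply: (@mpoly_rmorph_eq _ _ _ g R_to_rees) => [c|i]; rewrite /g /=.
  by rewrite map_mpolyC /phi mmapC /= mmapC.
by rewrite map_mpolyX; apply: phi_X.
Qed.

Fact phi_psi (f : T) : val (phi f%:MP) = val (psi f).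
Proof.
pose g1 : {rmorphism T -> Rt} := val \o (phi \o @mpolyC n T).
pose g2 : {rmorphism T -> Rt} := val \o psi.
apply: (@mpoly_rmorph_eq _ _ _ g1 g2) => [c|v]; rewrite /g1 /g2 /=.
  by rewrite /phi /psi mmapC /= !mmapC.
by rewrite -[v]enum_valK -/(Tvar _) phi_T psi_T.
Qed.

(* The pairs (l, j) with j in J'_(a_l), in the lexicographic order of         *)
(* (l, j_(n-1), ..., j_1).                                                    *)
Definition colkey (c : colidx) : seqlexi nat :=
  (tag c : nat) :: rev (map val (val (tagged c))).

Definition cols : seq colidx :=
  sort (fun c c' => (colkey c <= colkey c')%O)
       [seq c <- enum {: colidx} | (0 < cj c 1)%N].

(* Rows are numbered from 0, hence the entry T_(l, j, s.+1) in row s.         *)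
Definition Bmx : 'M[T]_(n, size cols) :=
  \matrix_(s < n, q < size cols) Tvar (clower (tnth (in_tuple cols) q) s.+1).

Definition Cmx : 'M[S]_(n, 1 + size cols) :=
  row_mx (\col_(s < n) ('X_s : S)) (map_mx (@mpolyC n T) Bmx).

End ReesAlgebra.

Arguments k_to_rees k n [r] a _.
Arguments k_to_fiber k n [r] a _.
Arguments rees_gens k n [r] a _.
Arguments fiber_xt k n [r] a _.
Arguments phi k n [r] a _.
Arguments psi k n [r] a _.

(* Main.v *)
From HB Require Import structures.
Require Import Defs.
From mathcomp Require Import all_boot all_order all_algebra.
From mathcomp Require Import boolp.
From mathcomp Require Import mpoly.
From mathcomp Require Import zify ring.

(* Giving the variables x_i a label 0 and the T_(l,j) the label l + 1, both   *)
(* algebras are monoid algebras whose generators are all pairs (label,        *)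
(* monomial of the degree attached to the label).                             *)
(* Presentation: two words of generators with the same product are connected  *)
(* by exchanges x_p <-> x_q between two letters, and such an exchange is a    *)
(* 2-minor.                                                                   *)
(* Koszulness: the ideals generated, for a function sigma on labels, by the   *)
(* generators of label l divisible by one of x_1, ..., x_(sigma l) have       *)
(* successive colon ideals of the same form when the generators are sorted by *)
(* label, then by decreasing monomial. Hence the syzygies of the residue      *)
(* field can be computed step by step with linear entries.                    *)
(* Normality: an element p / q integral over the algebra satisfies            *)
(* q^N | d p^N for a fixed d and all N; the monoid of exponents is            *)
(* saturated, so leading monomials can be cancelled until q | p.              *)

Set Implicit Arguments.
Unset Strict Implicit.
Unset Printing Implicit Defensive.

Import Order.TTheory GRing.Theory.
Local Open Scope ring_scope.

(** * Linear quotients and linear syzygies *)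

(** Give x_i the label 0 and T_(l,j) the label of l, and let a word of these generators stand for
    the monomial of k[x][t] that it maps to. Words with the same image are those with the same
    multiset of labels and the same product of x-parts ([weq_exponents]). Every label carries all
    monomials of its degree, so between two letters a factor x_p of one can be traded for a factor
    x_q of the other. This exchange property drives the relations and the Koszul property.

    Presentation: if the product of a word is divisible by a generator with an available label,
    exchanges bring that generator to the front ([connect_head]), so exchanges connect all words
    with the same image ([weq_connect]). A column of B lists the monomials x_s u / x_1
    ([jmon_lower]), hence each exchange is a 2-minor ([minors2_exchange]). Grouping the terms of a
    kernel element by their image gives the kernel ([toric_kernel]).

    Koszulness: consider the ideals generated by the generators of label l divisible by one of the
    first sigma(l) variables. In a suitable order, each colon of a generator by the previous ones is
    again of this form ([colon_words], [toric_filtration]). Over such a family, a matrix of linear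
    forms whose rows have colons in the family has a syzygy module generated by linear rows with the
    same property ([syz_exists]), so a linear resolution of the residue field is built step by step
    ([koszul_mx_resolution]).

    Normality: the exponents that occur are those whose x-degree equals (fiber) or is at least
    (Rees) the weight of the t-part. This cone is saturated ([in_cone_saturated]). Integral elements
    are almost integral ([integral_almost_integral]), and saturation lets the division algorithm on
    leading monomials finish ([monomial_subring_cic]). *)

Section LinearSpan.

Variables (A : comNzRingType) (V : lmodType A).
Implicit Types (L : seq V) (v z : V).

(** Peeling off one generator at a time makes spans of prefixes and concatenations accessible by
    induction, as needed for successive colons. *)
Fixpoint lspan L v : Prop :=
  if L is z :: L' then exists c : A, lspan L' (v - c *: z) else v = 0.

Lemma lspan0 L : lspan L 0.
Proof. by elim: L => //= z L IH; exists 0; rewrite scale0r subr0. Qed.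

Lemma lspanD L v1 v2 : lspan L v1 -> lspan L v2 -> lspan L (v1 + v2).
Proof.
elim: L v1 v2 => [|z L IH] v1 v2 /=; first by move=> -> ->; rewrite addr0.
move=> [c1 H1] [c2 H2]; exists (c1 + c2).
by rewrite scalerDl opprD addrACA; apply: IH.
Qed.

Lemma lspanZ L c v : lspan L v -> lspan L (c *: v).
Proof.
elim: L v => [|z L IH] v /=; first by move=> ->; rewrite scaler0.
by move=> [d Hd]; exists (c * d); rewrite -scalerA -scalerBr; apply: IH.
Qed.

Lemma lspan_cat L1 L2 v :
  lspan (L1 ++ L2) v <-> exists2 v1, lspan L1 v1 & lspan L2 (v - v1).
Proof.
elim: L1 v => [|z L IH] v /=.
  by split=> [H|[v1 ->]]; [exists 0; rewrite ?subr0|rewrite subr0].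
split=> [[c /IH[v1 H1 H2]]|[v1 [c H1] H2]].
  exists (v1 + c *: z); first by exists c; rewrite addrK.
  by rewrite opprD addrCA addrC.
by exists c; apply/IH; exists (v1 - c *: z); rewrite // opprB addrA subrK.
Qed.

Lemma lspan_mem L z : z \in L -> lspan L z.
Proof.
elim: L => //= y L IH; rewrite inE => /orP[/eqP->|/IH H].
  by exists 1; rewrite scale1r subrr; apply: lspan0.
by exists 0; rewrite scale0r subr0.
Qed.

Lemma lspan_sum (J : Type) (r : seq J) (P : pred J) (G : J -> V) L :
  (forall j, P j -> lspan L (G j)) -> lspan L (\sum_(j <- r | P j) G j).
Proof.
by move=> H; elim/big_rec: _ => [|j v Pj Hv];
  [apply: lspan0|apply: lspanD => //; apply: H].
Qed.

Lemma lspan_rect (P : V -> Prop) L :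
    P 0 -> (forall v1 v2, P v1 -> P v2 -> P (v1 + v2)) ->
    (forall c z, z \in L -> P (c *: z)) ->
  forall v, lspan L v -> P v.
Proof.
move=> P0 PD; elim: L => [|z L IH] PZ v /=; first by move=> ->.
move=> [c Hc]; rewrite -(subrK (c *: z) v); apply: PD.
  by apply: IH Hc => d y Ly; apply: PZ; rewrite inE Ly orbT.
by apply: PZ; rewrite mem_head.
Qed.

Lemma lspan_codom p (f : 'I_p -> V) (P : pred 'I_p) v :
  lspan [seq f j | j <- enum P] v <->
  exists2 c : 'I_p -> A, (forall j, ~~ P j -> c j = 0)
    & v = \sum_j c j *: f j.
Proof.
split.
  move: v; apply: lspan_rect.
  - by exists (fun _ => 0) => //; rewrite big1 // => j _; rewrite scale0r.
  - move=> v1 v2 [c1 P1 ->] [c2 P2 ->]; exists (fun j => c1 j + c2 j).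
      by move=> j nPj; rewrite P1 ?P2 ?addr0.
    by rewrite -big_split; apply: eq_bigr => j _; rewrite scalerDl.
  - move=> c z /mapP[j]; rewrite mem_enum => Pj ->.
    exists (fun i => if i == j then c else 0).
      by move=> i; case: eqP => // -> /negP[].
    rewrite (bigD1 j) //= eqxx big1 ?addr0 // => i /negPf->.
    by rewrite scale0r.
move=> [c c0 ->]; apply: lspan_sum => j _.
have [Pj|/c0->] := boolP (P j); last by rewrite scale0r; apply: lspan0.
by apply/lspanZ/lspan_mem/map_f; rewrite mem_enum.
Qed.

End LinearSpan.

Section LinearImage.

Variables (A : comNzRingType) (V W : lmodType A) (h : {linear V -> W}).

Lemma lspan_map L v : lspan L v -> lspan (map h L) (h v).
Proof.
elim: L v => [|z L IH] v /=; first by move=> ->; rewrite linear0.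
by move=> [c /IH]; rewrite linearB linearZ => H; exists c.
Qed.

Lemma lspan_map_lift L x :
  lspan (map h L) x -> exists2 y, lspan L y & h y = x.
Proof.
elim: L x => [|z L IH] x /=; first by move=> ->; exists 0; rewrite ?linear0.
move=> [c /IH[y Ly hy]]; exists (y + c *: z); first by exists c; rewrite addrK.
by rewrite linearD linearZ hy subrK.
Qed.

Lemma lspan_map0 L x : (forall z, z \in L -> h z = 0) ->
  lspan (map h L) x -> x = 0.
Proof.
move=> L0 /lspan_map_lift[y Ly <-]; move: y Ly; apply: lspan_rect.
- exact: linear0.
- by move=> v1 v2 e1 e2; rewrite linearD e1 e2 addr0.
- by move=> c z /L0 e; rewrite linearZ /= e scaler0.
Qed.

End LinearImage.

Section ColonIdeals.

Variables (A : comNzRingType) (F : seq A^o -> Prop).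

(** The list lives in a module, so that the same condition applies to generators of an ideal and to
    the rows of a matrix. *)
Definition linear_quotients (V : lmodType A) (L : seq V) : Prop :=
  forall L1 z L2, L = L1 ++ z :: L2 ->
  exists2 s, F s & forall c, lspan L1 (c *: z) <-> lspan s c.

(* Weaker than the usual notion of a Koszul filtration: the ideals generated  *)
(* by the prefixes of [s] need not belong to the family, only their colons.   *)
Definition koszul_filtration (lin : A -> Prop) : Prop :=
  forall s, F s -> linear_quotients s /\ {in s, forall x, lin x}.

End ColonIdeals.

(** * Linear syzygies of matrices whose rows have linear quotients *)

Section SyzygyStep.

Variables (A : comNzRingType) (F : seq A^o -> Prop) (lin : A -> Prop).
Hypothesis F_koszul : koszul_filtration F lin.
(** Abstract form of taking the degree-one part of a syzygy. Keeping zero coordinates zero preserves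
    the triangular supports used in [syz_exists]. *)
Hypothesis lin_lift : forall p q (X : 'M[A]_(p, q)) (v : 'rV_p) (i : 'I_p),
    (forall i j, lin (X i j)) -> v *m X = 0 -> lin (v 0 i) ->
  exists v' : 'rV_p, [/\ v' *m X = 0, v' 0 i = v 0 i,
    forall j, v 0 j = 0 -> v' 0 j = 0 & forall j, lin (v' 0 j)].

Definition rows p q (X : 'M[A]_(p, q)) : seq 'rV[A]_q :=
  [seq row i X | i <- enum 'I_p].

Definition koszul_mx p q (X : 'M[A]_(p, q)) : Prop :=
  (forall i j, lin (X i j)) /\ linear_quotients F (rows X).

Lemma rows_split p q (X : 'M[A]_(p, q)) (i : 'I_p) :
  exists L2, rows X = [seq row j X | j <- enum (fun j : 'I_p => j < i)%N]
                        ++ row i X :: L2.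
Proof.
exists [seq row j X | j <- drop i.+1 (enum 'I_p)].
rewrite /rows -[in LHS](cat_take_drop i (enum 'I_p)) map_cat.
congr (_ ++ _); last first.
  rewrite (drop_nth i) ?size_enum_ord //=; congr (row _ _ :: _).
  by apply: val_inj; rewrite /= nth_enum_ord.
congr map; apply: (inj_map val_inj).
rewrite map_take val_enum_ord take_iota (minn_idPl (ltnW (ltn_ord i))).
have -> : enum (fun j : 'I_p => (j < i)%N) =
    filter (fun j : 'I_p => (j < i)%N) (enum 'I_p).
  by rewrite [in RHS]enumT; apply: eq_filter.
rewrite -(filter_map val (fun j => (j < i)%N)) val_enum_ord.
have iota_split u w : (u <= w)%N -> iota 0 w = iota 0 u ++ iota u (w - u).
  by move=> uw; rewrite -[in LHS](subnKC uw) iotaD.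
rewrite (iota_split i p (ltnW (ltn_ord i))) filter_cat.
rewrite (eq_in_filter (a2 := predT)) ?filter_predT; last first.
  by move=> j; rewrite mem_iota /= => ->.
rewrite (eq_in_filter (a2 := pred0)) ?filter_pred0 ?cats0 // => j.
by rewrite mem_iota /= => /andP[ij _]; rewrite ltnNge ij.
Qed.

Lemma mulmx_row p q (X : 'M[A]_(p, q)) (v : 'rV_p) :
  v *m X = \sum_j v 0 j *: row j X.
Proof.
apply/rowP => t; rewrite mxE summxE.
by apply: eq_bigr => j _; rewrite !mxE.
Qed.

Lemma coord_linear p (i : 'I_p) : linear (fun v : 'rV[A]_p => v 0 i : A^o).
Proof. by move=> c x y; rewrite !mxE. Qed.

Section Step.

Variables (p q : nat) (X : 'M[A]_(p, q)).
Hypothesis koszulX : koszul_mx X.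

Definition syz_lt (i : nat) (v : 'rV[A]_p) : Prop :=
  v *m X = 0 /\ forall j : 'I_p, (i <= j)%N -> v 0 j = 0.

Lemma syz_lt0 i : syz_lt i 0.
Proof. by split=> [|j _]; rewrite ?mul0mx // mxE. Qed.

Lemma syz_ltD i v1 v2 : syz_lt i v1 -> syz_lt i v2 -> syz_lt i (v1 + v2).
Proof.
by move=> [e1 z1] [e2 z2]; split=> [|j ij];
  rewrite ?mulmxDl ?e1 ?e2 ?mxE ?z1 ?z2 ?addr0.
Qed.

Lemma syz_ltZ i c v : syz_lt i v -> syz_lt i (c *: v).
Proof.
by move=> [e z]; split=> [|j ij]; rewrite -?scalemxAl ?e ?mxE ?z ?scaler0 ?mulr0.
Qed.

Lemma lspan_syz_lt i L : (forall z, z \in L -> syz_lt i z) ->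
  forall v, lspan L v -> syz_lt i v.
Proof.
move=> HL; apply: lspan_rect.
- exact: syz_lt0.
- exact: syz_ltD.
- by move=> c z /HL; apply: syz_ltZ.
Qed.

(* Syzygies supported on the first [i] rows, by induction on [i]: the leading *)
(* coefficients at row [i] of the new ones form the colon ideal of row [i],   *)
(* which is generated by some [s] in [F]; lifts of the elements of [s],       *)
(* appended in the order of [s], have the same successive colons as [s].      *)
Lemma syz_exists (i : nat) : (i <= p)%N ->
  exists Z : seq 'rV[A]_p,
    [/\ forall z, z \in Z -> syz_lt i z /\ forall j, lin (z 0 j),
        linear_quotients F Z
      & forall v, syz_lt i v -> lspan Z v].
Proof.
elim: i => [_|i IH lt_ip].
  exists [::]; split=> //; first by case.
  by move=> v [_ v0]; apply/rowP => j; rewrite v0 ?mxE.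
have{IH} [Z [Zsyz Zgood Zspan]] := IH (ltnW lt_ip).
pose i' := Ordinal lt_ip.
have [linX goodX] := koszulX.
have [L2 /goodX[s Fs colon]] := rows_split X i'.
have [s_good s_lin] := F_koszul Fs.
pose h : {linear 'rV[A]_p -> A^o} :=
  HB.pack (fun v : 'rV[A]_p => v 0 i' : A^o)
    (GRing.isLinear.Build A 'rV[A]_p A^o *:%R _ (coord_linear i')).
have hE v : h v = v 0 i' by [].
have colon_syz c : lspan s c -> exists v, syz_lt i.+1 v /\ v 0 i' = c.
  move=> /colon/lspan_codom[d d0 cE].
  exists (\row_j (if j == i' then c else - d j)); split; last by rewrite mxE eqxx.
  have d0' (j : 'I_p) : (i <= j)%N -> d j = 0.
    by move=> ij; apply: d0; rewrite -leqNgt.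
  split=> [|j ij]; last first.
    rewrite mxE; case: eqP => [ji|_]; first by rewrite ji /= ltnn in ij.
    by rewrite d0' ?oppr0 // ltnW.
  rewrite mulmx_row (bigD1 i') //= mxE eqxx cE (bigD1 i') //= d0' // scale0r add0r.
  rewrite -big_split big1 //= => j /negPf ji.
  by rewrite mxE ji scaleNr subrr.
have syz_colon_in v : syz_lt i.+1 v -> lspan s (v 0 i').
  move=> [vX v0]; apply/colon/lspan_codom.
  exists (fun j : 'I_p => if (j < i)%N then - v 0 j else 0).
    by move=> j /negPf; rewrite /= => ->.
  move: vX; rewrite mulmx_row (bigD1 i') //= => /eqP; rewrite addr_eq0 => /eqP->.
  rewrite (bigD1 i' (P := xpredT)) //= ltnn scale0r add0r -sumrN.
  apply: eq_bigr => j ji; case: ltnP => ij; first by rewrite scaleNr.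
  rewrite v0 ?scale0r ?oppr0 // ltn_neqAle ij andbT.
  by apply: contra ji => /eqP e; apply/eqP/val_inj.
have lift_gens (t : seq A^o) : {in t, forall c, lin c /\ lspan s c} ->
    exists Y : seq 'rV[A]_p, map h Y = t /\
      forall z, z \in Y -> syz_lt i.+1 z /\ forall j, lin (z 0 j).
  elim: t => [_|c t IHt Ht]; first by exists [::].
  have [d td|Y [<- HY]] := IHt; first by apply: Ht; rewrite inE td orbT.
  have [lin_c sc] := Ht c (mem_head _ _).
  have [v [[vX v0] vi]] := colon_syz _ sc.
  have [|v' [v'X v'i v'0 v'lin]] := @lin_lift _ _ X v i' linX vX.
    by rewrite vi.
  exists (v' :: Y); split; first by rewrite /= v'i vi.
  move=> z; rewrite inE => /orP[/eqP->|/HY //]; split=> //.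
  by split=> // j ij; apply/v'0/v0.
have [|Y [sE Ysyz]] := lift_gens s.
  by move=> c sc; split; [apply: s_lin|apply: lspan_mem].
have Zsyz' z : z \in Z -> syz_lt i.+1 z.
  by move=> /Zsyz[[zX z0] _]; split=> // j ij; rewrite z0 // ltnW.
have drop_i v : syz_lt i.+1 v -> v 0 i' = 0 -> lspan Z v.
  move=> [vX v0] vi; apply: Zspan; split=> // j; rewrite leq_eqVlt.
  move=> /orP[/eqP e|/v0 //].
  by rewrite -vi; congr (v 0 _); apply: val_inj.
exists (Z ++ Y); split.
- move=> z; rewrite mem_cat => /orP[Zz|/Ysyz //]; split; first exact: Zsyz'.
  by have [] := Zsyz z Zz.
(* A prefix of [Z ++ Y] either stops inside [Z], where the induction hypothesis applies, or contains
   all of [Z] and stops inside [Y]. *)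
- move=> L1 z L3 /esym E; have [lt_Z|le_Z] := ltnP (size L1) (size Z).
    have: Z = L1 ++ z :: take (size Z - (size L1).+1) L3.
      have := congr1 (take (size Z)) E; rewrite [in RHS]take_size_cat //.
      move=> ZE; rewrite -[LHS]ZE.
      rewrite take_cat ltnNge (ltnW lt_Z) /=.
      by rewrite -(subnSK lt_Z).
    by move=> /Zgood.
  have [Y1 L1E] : exists Y1, L1 = Z ++ Y1.
    exists (drop (size Z) L1); rewrite -[LHS](cat_take_drop (size Z)).
    congr (_ ++ _); have := congr1 (take (size Z)) E.
    by rewrite takel_cat // take_size_cat.
  move: E; rewrite L1E -catA => /eqP; rewrite eqseq_cat // eqxx /= => /eqP YE.
  have := s_good (map h Y1) (h z) (map h L3).
  rewrite -sE -YE map_cat map_cons => /(_ erefl)[s' Fs' colon'].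
  exists s' => // c; split.
    (* The coordinate [h] kills [Z], so a relation in [Z ++ Y] projects to one in [s]. Conversely a
       relation in [s] lifts to [Y] up to a syzygy with zero coordinate, which lies in the span of
       [Z]. *)
    move=> /lspan_cat[v1 Zv1] /(lspan_map h); rewrite linearB linearZ => H.
    apply/colon'; move: H; suff -> : h v1 = 0 by rewrite subr0.
    apply: (lspan_map0 (h := h) (L := Z)); last exact: lspan_map.
    by move=> y /Zsyz[[_ y0] _]; apply: y0.
  move=> /colon'/lspan_map_lift[y Yy hy].
  apply/lspan_cat; exists (c *: z - y); last by rewrite subKr.
  apply: drop_i; last by rewrite -hE linearB linearZ hy subrr.
  have Hz t : t \in z :: Y1 -> syz_lt i.+1 t.
    move=> Ht; suff: t \in Y by move=> /Ysyz[].
    rewrite -YE mem_cat orbC; move: Ht.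
    by rewrite !inE => /orP[->|->] //; rewrite orbT.
  apply: syz_ltD; first by apply: syz_ltZ; apply: Hz; rewrite mem_head.
  rewrite -scaleN1r; apply: syz_ltZ; apply: lspan_syz_lt Yy => t Yt.
  by apply: Hz; rewrite inE Yt orbT.
- move=> v Hv; have := syz_colon_in v Hv; rewrite -sE => /lspan_map_lift[y Yy hy].
  apply/lspan_cat; exists (v - y); last by rewrite subKr.
  apply: drop_i; last by rewrite -hE linearB hy subrr.
  apply: syz_ltD => //; rewrite -scaleN1r; apply: syz_ltZ.
  by apply: lspan_syz_lt Yy => t /Ysyz[].
Qed.

(** The property [koszul_mx] is an invariant of passing to syzygies, so this step can be iterated
    forever. *)
Lemma koszul_mx_syz : exists p' (X' : 'M[A]_(p', p)), koszul_mx X' /\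
  forall u : 'rV_p, u *m X = 0 <-> exists v, u = v *m X'.
Proof.
have [Z [Zsyz Zgood Zspan]] := syz_exists (leqnn p).
pose X' : 'M[A]_(size Z, p) := \matrix_(i < size Z) (tnth (in_tuple Z) i).
have rowE i : row i X' = tnth (in_tuple Z) i by rewrite rowK.
have rowsE : rows X' = Z.
  rewrite /rows (eq_map rowE) -[RHS](map_tnth_enum (in_tuple Z)).
  by [].
exists (size Z), X'; split.
  split=> [i j|]; last by rewrite rowsE.
  have [_ /(_ j)] := Zsyz _ (mem_tnth i (in_tuple Z)).
  by rewrite -rowE mxE.
move=> u; split=> [uX|[v ->]].
  have: lspan (rows X') u.
    by rewrite rowsE; apply: Zspan; split=> // j; rewrite leqNgt ltn_ord.
  move=> /(lspan_codom (fun i => row i X') predT)[c _ uE].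
  by exists (\row_j c j); rewrite mulmx_row uE; apply: eq_bigr => j _; rewrite mxE.
rewrite (mulmx_row X' v) mulmx_suml big1 // => j _.
by rewrite -scalemxAl rowE; have [[-> _] _] := Zsyz _ (mem_tnth j (in_tuple Z));
  rewrite scaler0.
Qed.

End Step.

Lemma koszul_mx_resolution p (X : 'M[A]_(p, 1)) : koszul_mx X ->
  exists (b : nat -> nat)
         (D : forall i, 'M[A]_(res_rank b i.+1, res_rank b i)),
    [/\ forall i s t, lin (D i s t),
        forall x : A, (exists v : 'rV_p, v *m X = x%:M) <->
                      (exists v, v *m D 0%N = x%:M)
      & forall i (u : 'rV[A]_(res_rank b i.+1)),
          u *m D i = 0 <-> exists v, u = v *m D i.+1].
Proof.
move=> koszulX.
pose state := {q : nat & {p : nat & {X : 'M[A]_(p, q) | koszul_mx X}}}.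
pose sp (st : state) := projT1 (projT2 st).
pose sX (st : state) := proj1_sig (projT2 (projT2 st)).
have next_ex (st : state) : {p' : nat & {X' : 'M[A]_(p', sp st) |
    koszul_mx X' /\
      forall u : 'rV_(sp st), u *m sX st = 0 <-> exists v, u = v *m X'}}.
  have /cid[p' /cid[X' HX']] := koszul_mx_syz (proj2_sig (projT2 (projT2 st))).
  by exists p', X'.
pose st0 : state := existT _ 1%N (existT _ p (exist _ X koszulX)).
pose nx st := projT1 (next_ex st).
pose nX st : 'M[A]_(nx st, sp st) := proj1_sig (projT2 (next_ex st)).
pose nxt (st : state) : state := existT _ (sp st) (existT _ (nx st)
  (exist _ (nX st) (proj1 (proj2_sig (projT2 (next_ex st)))))).
pose st i := iter i nxt st0.
pose b i := sp (st i).
(* The case split lets [res_rank b 0] reduce to 1 and the later ranks reduce to those stored in the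
   states. *)
pose D i : 'M[A]_(res_rank b i.+1, res_rank b i) :=
  match i return 'M[A]_(res_rank b i.+1, res_rank b i) with
  | 0 => sX st0
  | i'.+1 => nX (st i')
  end.
exists b, D; split.
- case=> [|i] s t; first exact: (proj1 koszulX).
  exact: (proj1 (proj1 (proj2_sig (projT2 (next_ex (st i)))))).
- by [].
- case=> [|i] u.
    exact: (proj2 (proj2_sig (projT2 (next_ex st0)))).
  exact: (proj2 (proj2_sig (projT2 (next_ex (st i.+1))))).
Qed.

End SyzygyStep.

(** * Standard graded algebras *)

Lemma map_split (T1 T2 : Type) (f : T1 -> T2) t L1 z L2 :
  map f t = L1 ++ z :: L2 ->
  exists t1 y t2, [/\ t = t1 ++ y :: t2, map f t1 = L1 & f y = z].
Proof.
elim: L1 t => [|x L1 IH] [|y t] //= [].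
  by move=> <- _; exists [::], y, t.
by move=> <- /IH[t1 [y' [t2 [-> <- <-]]]]; exists (y :: t1), y', t2.
Qed.

Section StandardGrading.

Variables (k : fieldType) (A : comNzRingType) (iota : {rmorphism k -> A}).
Variables (I : finType) (g : I -> A).
Local Notation comp := (std_comp iota g).

Definition mon (w : seq I) : A := \prod_(i <- w) g i.

Lemma mon_cat w1 w2 : mon (w1 ++ w2) = mon w1 * mon w2.
Proof. exact: big_cat. Qed.

Lemma mon_cons i w : mon (i :: w) = g i * mon w.
Proof. exact: big_cons. Qed.

Lemma std_comp0 d : comp d 0.
Proof. by exists (fun _ => 0); rewrite big1 // => w _; rewrite rmorph0 mul0r. Qed.

Lemma std_compD d x y : comp d x -> comp d y -> comp d (x + y).
Proof.
move=> [c1 ->] [c2 ->]; exists (fun w => c1 w + c2 w).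
by rewrite -big_split; apply: eq_bigr => w _; rewrite rmorphD mulrDl.
Qed.

Lemma std_compZ d c x : comp d x -> comp d (iota c * x).
Proof.
move=> [c1 ->]; exists (fun w => c * c1 w).
by rewrite mulr_sumr; apply: eq_bigr => w _; rewrite rmorphM mulrA.
Qed.

Lemma std_compN d x : comp d x -> comp d (- x).
Proof. by move=> /(std_compZ (-1)); rewrite rmorphN1 mulN1r. Qed.

Lemma std_comp_sum d (J : Type) (r : seq J) (P : pred J) (G : J -> A) :
  (forall j, P j -> comp d (G j)) -> comp d (\sum_(j <- r | P j) G j).
Proof.
by move=> H; elim/big_rec: _ => [|j v Pj Hv];
  [apply: std_comp0|apply: std_compD => //; apply: H].
Qed.

Lemma std_comp_mon c w : comp (size w) (iota c * mon w).
Proof.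
pose w0 := [ffun j => tnth (in_tuple w) j].
exists (fun w' => if w' == w0 then c else 0).
rewrite (bigD1 w0) //= eqxx [X in _ = _ + X]big1 ?addr0; last first.
  by move=> w' /negPf->; rewrite rmorph0 mul0r.
congr (_ * _); rewrite /mon -[w in LHS]/(val (in_tuple w)) big_tuple.
by apply: eq_bigr => j _; rewrite ffunE.
Qed.

Lemma std_comp_words d x : comp d x ->
  exists s : seq (k * seq I), {in s, forall t, size t.2 = d} /\
    x = \sum_(t <- s) iota t.1 * mon t.2.
Proof.
move=> [c ->]; exists [seq (c w, codom w) | w <- enum {ffun 'I_d -> I}]; split.
  by move=> t /mapP[w _ ->]; rewrite size_codom card_ord.
rewrite big_map big_enum; apply: eq_bigr => w _ /=; congr (_ * _).
by rewrite /mon codomE big_map big_enum.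
Qed.

Lemma std_compM d x y : comp d x -> comp 1 y -> comp d.+1 (x * y).
Proof.
move=> /std_comp_words[s [sd ->]] /std_comp_words[t [t1 ->]].
rewrite mulr_suml big_seq; apply: std_comp_sum => u /sd su.
rewrite mulr_sumr big_seq; apply: std_comp_sum => v /t1 tv.
rewrite mulrACA -rmorphM -mon_cat.
by have := std_comp_mon (u.1 * v.1) (u.2 ++ v.2); rewrite size_cat su tv addn1.
Qed.

Lemma std_comp_gen i : comp 1 (g i).
Proof.
have := std_comp_mon 1 [:: i].
by rewrite rmorph1 mul1r mon_cons /mon big_nil mulr1.
Qed.

Lemma big_ord_pad (f : nat -> A) m M : (m <= M)%N ->
  \sum_(d < M) (if (d < m)%N then f d else 0) = \sum_(d < m) f d.
Proof.
by move=> mM; rewrite -big_mkcond /= (big_ord_widen M f mM).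
Qed.

Hypothesis graded : std_graded iota g.

(** Any larger bound is allowed, so finitely many elements can share one. The last clause is what
    keeps zero coordinates zero in [std_lin_lift]. *)
Lemma comp_decomp x : exists (m : nat) (f : nat -> A),
  [/\ forall d, comp d (f d), forall M, (m <= M)%N -> x = \sum_(d < M) f d
    & x = 0 -> forall d, f d = 0].
Proof.
have [->|xN0] := eqVneq x 0.
  exists 0%N, (fun=> 0); split=> // [d|M _]; first exact: std_comp0.
  by rewrite big1.
have [m [f [fd ->]]] := graded.1 x.
exists m, (fun d => if (d < m)%N then f d else 0); split.
- by move=> d; case: ifP => // _; apply: std_comp0.
- by move=> M mM; rewrite big_ord_pad.
- move=> s0 d; case: ifP => // dm.
  exact: (graded.2 m f fd s0 d dm).
Qed.

(** Take the degree-one components of the coordinates. As [X] is linear, their product with [X] is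
    the degree-two part of [v *m X = 0], which vanishes because the grading is direct. *)
Lemma std_lin_lift p q (X : 'M[A]_(p, q)) (v : 'rV_p) (i : 'I_p) :
    (forall i j, comp 1 (X i j)) -> v *m X = 0 -> comp 1 (v 0 i) ->
  exists v' : 'rV_p, [/\ v' *m X = 0, v' 0 i = v 0 i,
    forall j, v 0 j = 0 -> v' 0 j = 0 & forall j, comp 1 (v' 0 j)].
Proof.
move=> linX vX vi.
have dec j : {m : nat & {f : nat -> A |
  [/\ forall d, comp d (f d), forall M, (m <= M)%N -> v 0 j = \sum_(d < M) f d
    & v 0 j = 0 -> forall d, f d = 0]}}.
  by have /cid[m /cid[f ?]] := comp_decomp (v 0 j); exists m, f.
pose f j := proj1_sig (projT2 (dec j)).
(* One bound for all coordinates; the 2 ensures that degree 1 lies below it. *)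
pose M := (\sum_j projT1 (dec j)).+2.
have fd j d : comp d (f j d) by rewrite /f; case: (dec j) => m [h []].
have fE j : v 0 j = \sum_(d < M) f j d.
  have mM : (projT1 (dec j) <= M)%N.
    by rewrite /M (bigD1 j) //= -addn2 -addnA leq_addr.
  by rewrite /f; case: (dec j) mM => m [h [_ hE _]] /= /hE.
exists (\row_j f j 1%N); split.
- apply/rowP => t; rewrite !mxE.
  pose e d := if d is d'.+1 then \sum_j f j d' * X j t else 0.
  have e_comp d : comp d (e d).
    case: d => [|d] /=; first exact: std_comp0.
    by apply: std_comp_sum => j _; apply: std_compM.
  rewrite (eq_bigr (fun j => f j 1%N * X j t)); last by move=> j _; rewrite mxE.
  apply: (graded.2 M.+1 e e_comp _ 2%N isT).
  rewrite big_ord_recl /= add0r exchange_big /=.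
  move: vX => /rowP/(_ t); rewrite !mxE => vXt; rewrite -[RHS]vXt.
  by apply: eq_bigr => j _; rewrite (fE j) mulr_suml.
- rewrite mxE; apply/eqP; rewrite -subr_eq0; apply/eqP.
  pose e d := f i d - (if d == 1%N then v 0 i else 0).
  have e_comp d : comp d (e d).
    apply: std_compD => //; apply: std_compN; case: eqP => [->//|_].
    exact: std_comp0.
  apply: (graded.2 M e e_comp _ 1%N isT).
  rewrite sumrB -fE -(big_mkcond (fun d : 'I_M => d == 1%N :> nat)) /=.
  by rewrite (big_pred1 (Ordinal (isT : (1 < M)%N))) ?subrr // => d.
- by move=> j v0; rewrite mxE /f; case: (dec j) => m [h [_ _ h0]] /=; apply: h0.
- by move=> j; rewrite mxE.
Qed.

Lemma irrelevantD x y :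
  irrelevant iota g x -> irrelevant iota g y -> irrelevant iota g (x + y).
Proof.
move=> [m1 [f1 [H1 ->]]] [m2 [f2 [H2 ->]]]; exists (maxn m1 m2).
exists (fun d => (if (d < m1)%N then f1 d else 0)
                 + (if (d < m2)%N then f2 d else 0)); split.
  by move=> d; apply: std_compD; case: ifP => // _; apply: std_comp0.
by rewrite big_split /= !big_ord_pad ?leq_maxl ?leq_maxr.
Qed.

Lemma irrelevant_lspan (s : seq I) x : (forall i, i \in s) ->
  irrelevant iota g x <-> lspan [seq (g i : A^o) | i <- s] x.
Proof.
move=> s_all; split.
  move=> [m [f [fd ->]]]; apply: lspan_sum => d _.
  have [c ->] := fd d; apply: lspan_sum => w _.
  rewrite big_ord_recl /= mulrCA mulrC.
  by apply/lspanZ/lspan_mem/map_f.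
apply: (@lspan_rect A A^o (irrelevant iota g)).
- by exists 0%N, (fun=> 0); split=> [d|]; rewrite ?big_ord0 //; apply: std_comp0.
- exact: irrelevantD.
- move=> c _ /mapP[i _ ->]; have [m [f [fd fE _]]] := comp_decomp c.
  rewrite (fE m (leqnn m)) /GRing.scale /= mulr_suml.
  exists m, (fun d => f d * g i); split=> // d.
  by apply: std_compM => //; apply: std_comp_gen.
Qed.

(** The iteration starts with the column of all generators: its row span is the irrelevant ideal,
    and its colons are those of the full list [s]. *)
Theorem koszul_filtration_koszul (F : seq A^o -> Prop) (s : seq I) :
    koszul_filtration F (comp 1) -> (forall i, i \in s) ->
    F [seq (g i : A^o) | i <- s] ->
  koszul iota g.
Proof.
move=> F_koszul s_all Fs; split=> //.
pose X : 'M[A]_(size s, 1) := \matrix_(i < size s, j < 1) g (tnth (in_tuple s) i).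
have [s_good s_lin] := F_koszul _ Fs.
pose h (x : A^o) : 'rV[A]_1 := x%:M.
have h_lin : linear h by move=> c x y; rewrite /h raddfD /= -scale_scalar_mx.
pose hl : {linear A^o -> 'rV[A]_1} :=
  HB.pack h (GRing.isLinear.Build A A^o 'rV[A]_1 *:%R _ h_lin).
have h_inj x y : h x = h y -> x = y.
  by move=> /rowP/(_ 0); rewrite !mxE eqxx.
have rowsX : rows X = map hl [seq (g i : A^o) | i <- s].
  rewrite /rows -[in RHS]map_comp -[s in RHS](map_tnth_enum (in_tuple s)).
  rewrite -[in RHS]map_comp.
  by apply: eq_map => i; apply/rowP => j; rewrite !mxE ord1 eqxx.
have lspan_h L x : lspan (map hl L) (h x) <-> lspan L x.
  split=> [/lspan_map_lift[y Ly /h_inj <-] //|]; exact: (lspan_map hl).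
have koszulX : koszul_mx F (comp 1) X.
  split=> [i j|]; first by rewrite mxE; apply: std_comp_gen.
  rewrite rowsX => L1 z L2 E; have [t1 [y [t2 [tE L1E zE]]]] := map_split E.
  rewrite -{}L1E -{}zE.
  have [s' Fs' colon] := s_good _ _ _ tE.
  exists s' => // c.
  have -> : c *: hl y = h (c *: y) by rewrite -[h _]/(hl _) linearZ.
  by rewrite lspan_h; apply: colon.
have [b [D [D_lin D0 D_ex]]] := koszul_mx_resolution F_koszul std_lin_lift koszulX.
exists b, D; split=> // x.
rewrite irrelevant_lspan // -D0 -lspan_h -rowsX.
rewrite (lspan_codom (fun i => row i X) predT); split.
  by move=> [c _ hx]; exists (\row_j c j); rewrite mulmx_row -[x%:M]/(h x) hx;
    apply: eq_bigr => j _; rewrite mxE.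
by move=> [v vE]; exists (v 0); rewrite // -mulmx_row.
Qed.

End StandardGrading.

(** * Words of generators *)

Section ToricWords.

Variables (n : nat) (I : finType) (lab : I -> nat) (u : I -> 'X_{1..n}).

(* A generator [i] stands for the monomial [x ^ u i * t_(lab i)]; [weq] is    *)
(* equality of the monomials represented by two words.                        *)
Definition usum (w : seq I) : 'X_{1..n} := (\sum_(i <- w) u i)%MM.

Definition weq (w w' : seq I) : bool :=
  perm_eq (map lab w) (map lab w') && (usum w == usum w').

Lemma usum_cons i w : usum (i :: w) = (u i + usum w)%MM.
Proof. exact: big_cons. Qed.

Lemma usum_cat w1 w2 : usum (w1 ++ w2) = (usum w1 + usum w2)%MM.
Proof. exact: big_cat. Qed.

Lemma weq_refl w : weq w w.
Proof. by rewrite /weq perm_refl eqxx. Qed.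

Lemma weq_sym w w' : weq w w' = weq w' w.
Proof. by rewrite /weq perm_sym eq_sym. Qed.

Lemma weq_trans w2 w1 w3 : weq w1 w2 -> weq w2 w3 -> weq w1 w3.
Proof.
move=> /andP[p1 /eqP e1] /andP[p2 /eqP e2].
by rewrite /weq (perm_trans p1 p2) e1 e2 /=.
Qed.

Lemma weq_perm w w' : perm_eq w w' -> weq w w'.
Proof. by move=> p; rewrite /weq perm_map //= /usum (perm_big _ p). Qed.

Lemma weq_cat w1 w2 w1' w2' :
  weq w1 w1' -> weq w2 w2' -> weq (w1 ++ w2) (w1' ++ w2').
Proof.
move=> /andP[p1 /eqP e1] /andP[p2 /eqP e2].
by rewrite /weq !map_cat perm_cat //= !usum_cat e1 e2.
Qed.

Lemma weq_cons2 i w w' : weq (i :: w) (i :: w') = weq w w'.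
Proof. by rewrite /weq /= perm_cons !usum_cons (inj_eq (@addmI _ _)). Qed.

Lemma weq_size w w' : weq w w' -> size w = size w'.
Proof. by move=> /andP[/perm_size]; rewrite !size_map. Qed.

Lemma weq_nil w : weq [::] w -> w = [::].
Proof. by move=> /weq_size/esym/size0nil. Qed.

Lemma usum_gt0 w p : (0 < usum w p)%N -> exists2 i, i \in w & (0 < u i p)%N.
Proof.
elim: w => [|i w IH]; first by rewrite /usum big_nil mnm0E.
rewrite usum_cons mnmDE; have [u0|up _] := posnP (u i p).
  by rewrite u0 => /IH[j wj uj]; exists j; rewrite // inE wj orbT.
by exists i; rewrite ?mem_head.
Qed.

Lemma mdeg_gt0_ex (m : 'X_{1..n}) : (0 < mdeg m)%N -> exists p, (0 < m p)%N.
Proof.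
rewrite lt0n mdeg_eq0 => mN0; apply/existsP; apply: contraR mN0.
rewrite negb_exists => /forallP m0; apply/eqP/mnmP => p.
by move: (m0 p); rewrite mnm0E lt0n negbK => /eqP.
Qed.

Lemma mdeg_lem (m m' : 'X_{1..n}) : (m <= m')%MM -> (mdeg m <= mdeg m')%N.
Proof. by move=> /mnm_lepP le_m; rewrite !mdegE; apply: leq_sum. Qed.

Lemma mnm_between d (lo hi : 'X_{1..n}) :
    (lo <= hi)%MM -> (mdeg lo <= d <= mdeg hi)%N ->
  exists m, [/\ (lo <= m)%MM, (m <= hi)%MM & mdeg m = d].
Proof.
elim: d => [|d IH] lohi.
  by rewrite leqn0 => /andP[/eqP d0 _]; exists lo; split=> //; apply: lepm_refl.
rewrite leq_eqVlt ltnS => /andP[/orP[/eqP <- _|lo_d d_hi]].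
  by exists lo; split=> //; apply: lepm_refl.
have [|m [lom mhi md]] := IH lohi; first by rewrite lo_d ltnW.
have [|p] := @mdeg_gt0_ex (hi - m)%MM.
  by have := congr1 mdeg (submK mhi); rewrite mdegD md; lia.
rewrite mnmBE subn_gt0 => p_lt; exists (m + U_(p))%MM; split.
- by apply: lepm_trans lom _; apply: lem_addr.
- apply/mnm_lepP => q; rewrite mnmDE mnm1E; move/mnm_lepP: mhi => /(_ q).
  by have [<-|_] := eqVneq p q; lia.
- by rewrite mdegD mdeg1 md addn1.
Qed.

Hypothesis lab_u_inj : forall i j, lab i = lab j -> u i = u j -> i = j.
Hypothesis lab_mdeg : forall i j, lab i = lab j -> mdeg (u i) = mdeg (u j).
Hypothesis u_surj : forall i m, mdeg m = mdeg (u i) ->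
  exists j, lab j = lab i /\ u j = m.
Hypothesis u_gt0 : forall i, (0 < mdeg (u i))%N.

(** Greedily split off a divisor of [m] of the degree of the first letter; every monomial of that
    degree occurs under its label. *)
Lemma word_realize w m : mdeg m = mdeg (usum w) ->
  exists w', map lab w' = map lab w /\ usum w' = m.
Proof.
elim: w m => [|i w IH] m.
  rewrite /usum big_nil mdeg0 => /eqP; rewrite mdeg_eq0 => /eqP->.
  by exists [::]; rewrite big_nil.
rewrite usum_cons mdegD => md.
have [||m1 [_ m1m m1d]] := @mnm_between (mdeg (u i)) 0%MM m.
- by apply/mnm_lepP => p; rewrite mnm0E.
- by rewrite mdeg0 md leq_addr.
have [j [lj uj]] := u_surj m1d.
have [|w' [lw' uw']] := IH (m - m1)%MM.
  by have := congr1 mdeg (submK m1m); rewrite mdegD md m1d; lia.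
exists (j :: w'); rewrite /= lj lw' usum_cons uj uw'; split=> //.
by rewrite addmC submK.
Qed.

Lemma word_divide i w : lab i \in map lab w -> (u i <= usum w)%MM ->
  exists w', weq w (i :: w').
Proof.
move=> /mapP[j wj lij] iw.
have pw := perm_to_rem wj.
have uE : usum w = (u j + usum (rem j w))%MM.
  by rewrite -usum_cons /usum (perm_big _ pw).
have [|w' [lw' uw']] := @word_realize (rem j w) (usum w - u i)%MM.
  have := congr1 mdeg (submK iw); rewrite {2}uE !mdegD (lab_mdeg lij).
  by move=> /eqP; rewrite addnC eqn_add2l => /eqP.
exists w'; rewrite /weq usum_cons uw' addmC submK // eqxx andbT /= lw' lij.
by rewrite -map_cons perm_map.
Qed.

Lemma gen_exchange i p q : (0 < u i p)%N ->
  exists i', lab i' = lab i /\ (u i' + U_(p) = u i + U_(q))%MM.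
Proof.
move=> ip; have pi : (U_(p) <= u i)%MM by rewrite lep1mP -lt0n.
have [|i' [li' ui']] := @u_surj i (u i - U_(p) + U_(q))%MM.
  by have := congr1 mdeg (submK pi); rewrite !mdegD !mdeg1.
exists i'; split=> //; rewrite ui' -addmA [(U_(q) + _)%MM]addmC addmA.
by rewrite submK.
Qed.

Lemma weq_exchange i j i' j' p q : lab i' = lab i -> lab j' = lab j ->
  (u i' + U_(p) = u i + U_(q))%MM -> (u j' + U_(q) = u j + U_(p))%MM ->
  weq [:: i; j] [:: i'; j'].
Proof.
move=> li lj ui uj; rewrite /weq /= li lj perm_refl /=.
rewrite /usum !big_cons !big_nil !addm0; apply/eqP/mnmP => t.
move: ui uj => /mnmP/(_ t); rewrite !mnmDE => ui /mnmP/(_ t); rewrite !mnmDE; lia.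
Qed.

(** * Connecting equivalent words by exchanges *)

Section Connectivity.

Variable C : seq I -> seq I -> Prop.
Hypothesis C_perm : forall w w', perm_eq w w' -> C w w'.
Hypothesis C_sym : forall w w', C w w' -> C w' w.
Hypothesis C_trans : forall w2 w1 w3, C w1 w2 -> C w2 w3 -> C w1 w3.
Hypothesis C_cons : forall i w w', C w w' -> C (i :: w) (i :: w').
Hypothesis C_exchange : forall i j i' j' w p q,
  lab i' = lab i -> lab j' = lab j ->
  (u i' + U_(p) = u i + U_(q))%MM -> (u j' + U_(q) = u j + U_(p))%MM ->
  C [:: i, j & w] [:: i', j' & w].

(** Induction on the degree of [u i - u j]: an excess factor x_t of [j] is traded for a missing x_s
    held by another letter, and this degree drops by one. *)
Lemma connect_head i j w : lab j = lab i -> (u i <= usum (j :: w))%MM ->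
  exists w', C (j :: w) (i :: w') /\ weq (j :: w) (i :: w').
Proof.
have [d] := ubnP (mdeg (u i - u j)); elim: d j w => // d IH j w le_d lij iw.
have [ui|] := eqVneq (mdeg (u i - u j)) 0%N.
  have ij : (u i <= u j)%MM.
    move/eqP: ui; rewrite mdeg_eq0 => /eqP/mnmP ui; apply/mnm_lepP => t.
    by move: (ui t); rewrite mnmBE mnm0E; lia.
  have uE : u i = u j.
    have := congr1 mdeg (submK ij); rewrite mdegD (lab_mdeg lij) => /eqP.
    rewrite -{2}[mdeg (u i)]add0n eqn_add2r mdeg_eq0 => /eqP e.
    by rewrite -(submK ij) e add0m.
  rewrite (lab_u_inj lij (esym uE)); exists w.
  by split; [apply: C_perm|apply: weq_refl].
rewrite -lt0n => /mdeg_gt0_ex[s]; rewrite mnmBE subn_gt0 => js.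
have [t jt] : exists t, (u i t < u j t)%N.
  apply/existsP; apply: contraLR js => /existsPn le_ji; rewrite -leqNgt.
  have ji : (u j <= u i)%MM by apply/mnm_lepP => t; rewrite leqNgt.
  have := congr1 mdeg (submK ji); rewrite mdegD (lab_mdeg lij) => /eqP.
  rewrite -{2}[mdeg (u i)]add0n eqn_add2r mdeg_eq0 => /eqP e.
  by rewrite -(submK ji) e add0m.
(* The whole product contains x_s more often than [u j] does, so some letter of [w] supplies it. *)
have [j2 j2w j2s] : exists2 j2, j2 \in w & (0 < u j2 s)%N.
  apply: usum_gt0; move/mnm_lepP: iw => /(_ s); rewrite usum_cons mnmDE; lia.
have [j' [lj' uj']] := @gen_exchange j t s (leq_ltn_trans (leq0n _) jt).
have [j2' [lj2' uj2']] := @gen_exchange j2 s t j2s.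
have step : C (j :: w) [:: j', j2' & rem j2 w].
  apply: (C_trans (w2 := [:: j, j2 & rem j2 w])); last exact: C_exchange uj' uj2'.
  by apply: C_perm; rewrite perm_cons perm_to_rem.
have wstep : weq (j :: w) [:: j', j2' & rem j2 w].
  apply: (weq_trans (w2 := [:: j, j2 & rem j2 w])).
    by apply: weq_perm; rewrite perm_cons perm_to_rem.
  apply: (@weq_cat [:: j; j2] _ [:: j'; j2']); last exact: weq_refl.
  exact: weq_exchange uj' uj2'.
have [|||w' [Cw' ww']] := IH j' (j2' :: rem j2 w).
- suff: ((u i - u j') + U_(s) = u i - u j)%MM.
    by move=> /(congr1 mdeg); rewrite mdegD mdeg1; lia.
  apply/mnmP => x; move/mnmP: uj' => /(_ x); rewrite !(mnmDE, mnmBE, mnm1E).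
  by move: js jt; case: (eqVneq s x) => [<-|_]; case: (eqVneq t _) => [<-|_]; lia.
- by rewrite lj'.
- by move: wstep => /andP[_ /eqP <-].
exists w'; split; first exact: C_trans step Cw'.
exact: weq_trans wstep ww'.
Qed.

Lemma weq_connect w w' : weq w w' -> C w w'.
Proof.
elim: w w' => [w' /weq_nil->|i w IH w' ww']; first exact: C_perm.
have /mapP[j w'j lij] : lab i \in map lab w'.
  by move: ww' => /andP[/perm_mem/(_ (lab i)) <-]; rewrite mem_head.
have pw := perm_to_rem w'j.
have ww2 := weq_trans ww' (weq_perm pw).
have [|w2 [Cw2 ww3]] := @connect_head i j (rem j w') (esym lij).
  by move: ww2 => /andP[_ /eqP <-]; rewrite usum_cons lem_addr.
apply: C_trans (C_sym (C_perm pw)); apply: C_trans (C_sym Cw2).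
by apply/C_cons/IH; rewrite -(weq_cons2 i); apply: weq_trans ww2 ww3.
Qed.

End Connectivity.

(** * Colon ideals of the filtration, in terms of words *)

Section Filtration.

(* The generators of the ideals of the Koszul filtration.                     *)
Definition wfil (sigma : nat -> nat) (i : I) : bool :=
  [exists p : 'I_n, (p < sigma (lab i))%N && (0 < u i p)%N].

Definition prec (j i : I) : bool :=
  (lab j < lab i)%N || (lab j == lab i) && (u i < u j)%O.

Definition top_var (i : I) : nat := \max_(p < n | (0 < u i p)%N) p.

(* If [j] precedes [i] with the same label, then [x_p] divides [u j / u i] in *)
(* lowest terms for some [p < top_var i], and each [x_p] with [p < top_var i] *)
(* is reached by exchanging [x_(top_var i)] for it in [u i]. For a smaller    *)
(* label [l], a common variable among the first [sigma l] ones makes every    *)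
(* generator of label [l] belong to the colon ideal.                          *)
Definition colon_sigma (sigma : nat -> nat) (i : I) (l : nat) : nat :=
  if (lab i <= l)%N then top_var i
  else if [exists p : 'I_n, (p < sigma l)%N && (0 < u i p)%N] then n
  else maxn (sigma l) (top_var i).

Lemma top_var_max i p : (0 < u i p)%N -> (p <= top_var i)%N.
Proof. by move=> ip; apply: leq_bigmax_cond. Qed.

Lemma top_var_ex i : exists2 p : 'I_n, (0 < u i p)%N & top_var i = p.
Proof.
have [p ip] := mdeg_gt0_ex (u_gt0 i).
have [|q iq E] := @eq_bigmax_cond _ (fun p => 0 < u i p)%N
    (fun p : 'I_n => p : nat).
  by apply/card_gt0P; exists p.
by exists q.
Qed.

Lemma top_var_lt i : (top_var i < n)%N.
Proof. by have [p _ ->] := top_var_ex i. Qed.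

Lemma colon_sigma_ge sigma i l : (top_var i <= colon_sigma sigma i l)%N.
Proof.
rewrite /colon_sigma; case: ifP => // _; case: ifP => _; last exact: leq_maxr.
exact/ltnW/top_var_lt.
Qed.

Lemma colon_words sigma i w : wfil sigma i ->
  (exists j w', [/\ wfil sigma j, prec j i & weq (i :: w) (j :: w')]) <->
  (exists j w', wfil (colon_sigma sigma i) j /\ weq w (j :: w')).
Proof.
move=> Wi; split=> [[j [w' [Wj ji ww']]]|[j [w' [Wj ww']]]].
  have uE t : (u i t + usum w t = u j t + usum w' t)%N.
    by move: ww' => /andP[_ /eqP/mnmP/(_ t)]; rewrite !usum_cons !mnmDE.
  move: ji => /orP[lt_ji|/andP[/eqP lji uji]].
    have lj : lab j \in map lab w.
      move: ww' => /andP[/perm_mem/(_ (lab j))]; rewrite /= mem_head inE.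
      by rewrite (ltn_eqF lt_ji).
    (* A divisor of [w] of the degree of label [lab j] that contains the part of [u j] not supplied
       by [u i]; a small variable of [j] absent from [i] survives in it. *)
    have [||m [lo_m m_w md]] := @mnm_between (mdeg (u j)) (u j - u i)%MM (usum w).
    - by apply/mnm_lepP => t; rewrite mnmBE; move: (uE t); lia.
    - rewrite (mdeg_lem (lem_subr _ _)) /=.
      move: lj => /mapP[j2 wj2 lj2]; rewrite (lab_mdeg lj2).
      by rewrite /usum (perm_big _ (perm_to_rem wj2)) big_cons /= mdegD leq_addr.
    have [j' [lj' uj']] := u_surj md.
    have [||w2 ww2] := @word_divide j' w.
    - by rewrite lj'.
    - by rewrite uj'.
    exists j', w2; split=> //; apply/existsP.
    rewrite /colon_sigma lj' leqNgt lt_ji /=.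
    case: ifPn => [_|/existsPn Hn].
      have [p jp] := mdeg_gt0_ex (u_gt0 j'); exists p.
      by rewrite ltn_ord.
    move/existsP: Wj => [p /andP[ps jp]]; exists p.
    rewrite leq_max ps /= uj'; move/mnm_lepP: lo_m => /(_ p); rewrite mnmBE.
    by move: (Hn p); rewrite ps /=; lia.
  move: uji => /(ltmcP (lab_mdeg (esym lji)))[p lt_p ijp].
  (* Equal degrees: the gain of [u j] at x_p is offset by a loss at some x_q. As p is the first
     difference, p < q, hence p lies below [top_var i]. *)
  have [q jiq] : exists q, (u j q < u i q)%N.
    apply/existsP; apply: contraLR ijp => /existsPn le_ij; rewrite -leqNgt.
    have ij : (u i <= u j)%MM by apply/mnm_lepP => t; rewrite leqNgt.
    have := congr1 mdeg (submK ij); rewrite mdegD (lab_mdeg lji) => /eqP.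
    rewrite -{2}[mdeg (u i)]add0n eqn_add2r mdeg_eq0 => /eqP e.
    by rewrite -(submK ij) e add0m.
  have lt_pq : (p < q)%N.
    rewrite ltnNge leq_eqVlt; apply/negP.
    move=> /orP[/eqP/val_inj pq|/lt_p]; last by lia.
    by move: ijp jiq; rewrite pq; lia.
  have [j' wj' j'p] : exists2 j', j' \in w & (0 < u j' p)%N.
    by apply: usum_gt0; move: (uE p); lia.
  exists j', (rem j' w); split; last exact/weq_perm/perm_to_rem.
  apply/existsP; exists p; rewrite j'p andbT.
  apply: leq_trans (colon_sigma_ge _ _ _); apply: (leq_trans lt_pq).
  by apply: top_var_max; lia.
suff [j1 [w1 [Wj1 ji1 ww1]]] : exists j1 w1,
    [/\ wfil sigma j1, prec j1 i & weq [:: i; j] (j1 :: w1)].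
  exists j1, (w1 ++ w'); split=> //.
  apply: (weq_trans (w2 := [:: i, j & w'])); first by rewrite weq_cons2.
  exact: (@weq_cat [:: i; j] _ (j1 :: w1) _ ww1 (weq_refl _)).
(* Trading the last variable of [i] for x_p gives a larger monomial of the same label, so an earlier
   generator. It stays in the ideal: if the lost variable was the witness, x_p replaces it. *)
have lower (p : 'I_n) : (p < top_var i)%N -> (0 < u j p)%N -> exists j1 w1,
    [/\ wfil sigma j1, prec j1 i & weq [:: i; j] (j1 :: w1)].
  have [q iq ->] := top_var_ex i => pq jp.
  have [i' [li' ui']] := @gen_exchange i q p iq.
  have [j' [lj' uj']] := @gen_exchange j p q jp.
  exists i', [:: j']; split; last exact: weq_exchange ui' uj'.
    move/existsP: Wi => [p0 /andP[p0s ip0]]; apply/existsP.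
    have [p0q|p0q] := eqVneq p0 q.
      exists p; rewrite li' (ltn_trans _ p0s) ?p0q //=.
      move/mnmP: ui' => /(_ p); rewrite !mnmDE !mnm1E eqxx.
      by rewrite -val_eqE /= (gtn_eqF pq) /=; lia.
    exists p0; rewrite li' p0s /=; move/mnmP: ui' => /(_ p0).
    by rewrite !mnmDE !mnm1E (eq_sym q) (negPf p0q); lia.
  rewrite /prec li' ltnn eqxx /=; apply/(ltmcP (lab_mdeg (esym li'))).
  exists p => [t tp|]; move/mnmP: ui'.
    move=> /(_ t); rewrite !mnmDE !mnm1E -!val_eqE /= (gtn_eqF tp).
    by rewrite (gtn_eqF (ltn_trans tp pq)) !addn0.
  move=> /(_ p); rewrite !mnmDE !mnm1E -!val_eqE /= eqxx (gtn_eqF pq) /=; lia.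
move/existsP: Wj => [p /andP[]]; rewrite /colon_sigma.
case: (leqP (lab i) (lab j)) => [_|lt_ji]; first exact: lower.
(* Here [i] owns a variable x_p0 that is small for the label of [j]; handing it over to [j] puts [j]
   into the ideal. *)
case: ifPn => [/existsP[p0 /andP[p0s ip0]] _ jp|_].
  have [i' [li' ui']] := @gen_exchange i p0 p ip0.
  have [j' [lj' uj']] := @gen_exchange j p p0 jp.
  exists j', [:: i']; split.
  - apply/existsP; exists p0; rewrite lj' p0s /=.
    move/mnmP: uj' => /(_ p0); rewrite !mnmDE !mnm1E eqxx.
    by have [<-|_] := eqVneq p p0; lia.
  - by rewrite /prec lj' lt_ji.
  - apply: (weq_trans (w2 := [:: j; i])); last exact: weq_exchange uj' ui'.
    by apply: weq_perm; rewrite (perm_catC [:: i]).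
rewrite leq_max => /orP[ps jp|]; last exact: lower.
exists j, [:: i]; split.
- by apply/existsP; exists p; rewrite ps.
- by rewrite /prec lt_ji.
- by apply: weq_perm; rewrite (perm_catC [:: i]).
Qed.

End Filtration.

End ToricWords.

(** * Koszul filtration and presentation of a toric ring *)

Lemma map_uniq_in_inj (T1 T2 : eqType) (f : T1 -> T2) (s : seq T1) :
  uniq (map f s) -> {in s &, injective f}.
Proof.
elim: s => //= x s IH /andP[fx uniq_s] y z; rewrite !inE.
move=> /orP[/eqP->|ys] /orP[/eqP->|zs] e //; last exact: IH.
- by rewrite e map_f in fx.
- by rewrite -e map_f in fx.
Qed.

Section ToricRing.

Variables (n : nat) (I : finType) (lab : I -> nat) (u : I -> 'X_{1..n}).
Hypothesis lab_u_inj : forall i j, lab i = lab j -> u i = u j -> i = j.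
Hypothesis lab_mdeg : forall i j, lab i = lab j -> mdeg (u i) = mdeg (u j).
Hypothesis u_surj : forall i m, mdeg m = mdeg (u i) ->
  exists j, lab j = lab i /\ u j = m.
Hypothesis u_gt0 : forall i, (0 < mdeg (u i))%N.
Local Notation weq := (weq lab u).
Local Notation wfil := (wfil lab u).
Local Notation prec := (prec lab u).

Lemma prec_irr i : prec i i = false.
Proof. by rewrite /prec ltnn eqxx ltxx. Qed.

Lemma prec_trans : transitive prec.
Proof.
rewrite /prec => j i l /orP[ij|/andP[/eqP-> uij]] /orP[jl|/andP[/eqP<- ujl]].
- by rewrite (ltn_trans ij jl).
- by rewrite ij.
- by rewrite jl.
- by rewrite eqxx (lt_trans ujl uij) orbT.
Qed.

Definition preceq j i := prec j i || (j == i).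

Lemma preceq_trans : transitive preceq.
Proof.
move=> j i l /orP[ij|/eqP->//] /orP[jl|/eqP<-]; rewrite /preceq ?ij //.
by rewrite (prec_trans ij jl).
Qed.

Lemma preceq_total : total preceq.
Proof.
move=> i j; rewrite /preceq /prec.
case: (ltngtP (lab i) (lab j)) => lij; rewrite /= ?orbT //.
case: (ltgtP (u i) (u j)) => uij; rewrite /= ?orbT //.
by rewrite (lab_u_inj lij uij) eqxx.
Qed.

Definition fil_gens sigma : seq I :=
  sort preceq [seq i <- enum I | wfil sigma i].

Lemma mem_fil_gens sigma i : (i \in fil_gens sigma) = wfil sigma i.
Proof. by rewrite mem_sort mem_filter mem_enum andbT. Qed.

Lemma fil_gens_prefix sigma s1 i s2 : fil_gens sigma = s1 ++ i :: s2 ->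
  forall j, (j \in s1) = wfil sigma j && prec j i.
Proof.
move=> E j; have := sort_sorted preceq_total [seq i <- enum I | wfil sigma i].
rewrite -/(fil_gens sigma) E (sorted_pairwise preceq_trans) pairwise_cat /=.
move=> /and3P[/allrelP s1_le _ /andP[/allP le_s2 _]].
have : uniq (fil_gens sigma) by rewrite sort_uniq filter_uniq ?enum_uniq.
rewrite E cat_uniq /= negb_or => /and3P[_ /andP[is1 _] _].
apply/idP/andP => [js1|[]].
  have := s1_le j i js1 (mem_head _ _); rewrite /preceq -mem_fil_gens E mem_cat js1.
  by move=> /orP[->//|/eqP ji]; rewrite -ji js1 in is1.
rewrite -mem_fil_gens E mem_cat inE => /or3P[//|/eqP->|/le_s2 /orP[ij|/eqP<-]].
- by rewrite prec_irr.
- by move=> /(prec_trans ij); rewrite prec_irr.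
- by rewrite prec_irr.
Qed.

Variables (k : fieldType) (A : comNzRingType) (iota : {rmorphism k -> A}).
Variables (g : I -> A) (E : eqType) (eps : seq I -> E).
Variable (coef : E -> {additive A -> k}).
(** [coef e] reads off the coefficient of the monomial with exponent [e], and [eps] gives the
    exponent of a word; distinct exponents are thereby linearly independent. *)
Hypothesis coef_mon : forall e c w,
  coef e (iota c * mon g w) = if eps w == e then c else 0.
Hypothesis eps_weq : forall w w', (eps w == eps w') = weq w w'.
Hypothesis mon_weq : forall w w', weq w w' -> mon g w = mon g w'.
Hypothesis mon_span : forall x, exists s : seq (k * seq I),
  x = \sum_(t <- s) iota t.1 * mon g t.2.

Lemma mon_normal_form x : exists ws : seq (seq I), uniq (map eps ws) /\
  x = \sum_(w <- ws) iota (coef (eps w) x) * mon g w.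
Proof.
have [s ->] := mon_span x; elim: s => [|[c w0] s [ws [uniq_ws xE]]].
  by exists [::]; rewrite !big_nil.
rewrite big_cons; set x' := \sum_(t <- s) _ in xE *; rewrite /=.
have [/mapP[w1 ws_w1 ew]|w0N] := boolP (eps w0 \in map eps ws).
  exists ws; split=> //.
  have wE w : w \in ws -> (eps w0 == eps w) = (w == w1).
    move=> ws_w; rewrite ew; apply/eqP/eqP => [e|->//].
    exact: (map_uniq_in_inj uniq_ws).
  rewrite [RHS](eq_big_seq (fun w => (if w == w1 then iota c * mon g w else 0)
                              + iota (coef (eps w) x') * mon g w)); last first.
    move=> w ws_w; rewrite raddfD /= coef_mon wE //; case: ifP => _.
      by rewrite rmorphD mulrDl.
    by rewrite !add0r.
  rewrite big_split -xE -big_mkcond /=; congr (_ + _).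
  rewrite (mon_weq (w' := w1)); last by rewrite -eps_weq ew.
  by rewrite -big_filter filter_pred1_uniq ?(map_uniq uniq_ws) // big_seq1.
exists (w0 :: ws); rewrite /= w0N; split=> //.
rewrite big_cons raddfD /= coef_mon eqxx.
have cx0 : coef (eps w0) x' = 0.
  rewrite xE raddf_sum big_seq big1 //= => w ws_w; rewrite coef_mon.
  by case: eqP => // e; rewrite -e map_f in w0N.
rewrite cx0 addr0; congr (_ + _); rewrite {1}xE !big_seq.
apply: eq_bigr => w ws_w; rewrite raddfD /= coef_mon; case: eqP => [e|_].
  by rewrite e map_f in w0N.
by rewrite add0r.
Qed.

Lemma coef_eq0 x : (forall w, coef (eps w) x = 0) -> x = 0.
Proof.
have [ws [_ xE]] := mon_normal_form x => x0; rewrite xE.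
by apply: big1 => w _; rewrite x0 rmorph0 mul0r.
Qed.

Lemma coef_std_comp d x w :
  std_comp iota g d x -> coef (eps w) x != 0 -> size w = d.
Proof.
move=> /std_comp_words[s [sd ->]].
rewrite raddf_sum; apply: contra_neq_eq => wd; rewrite big_seq big1 //= => t st.
rewrite coef_mon eps_weq; case: ifP => // /weq_size tw.
by move: wd; rewrite -tw sd ?eqxx.
Qed.

Lemma toric_std_graded : std_graded iota g.
Proof.
split=> [x|m f fd sum0 d dm].
  have [s ->] := mon_span x.
  pose m := (\max_(t <- s) size t.2).+1.
  exists m, (fun d => \sum_(t <- s | size t.2 == d) iota t.1 * mon g t.2); split.
    by move=> d; apply: std_comp_sum => t /eqP <-; apply: std_comp_mon.
  rewrite (exchange_big_dep xpredT) //= big_seq [RHS]big_seq.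
  apply: eq_bigr => t st.
  have tm : (size t.2 < m)%N by rewrite ltnS; apply: (leq_bigmax_seq t st).
  by rewrite (big_pred1 (Ordinal tm)) // => i; rewrite -val_eqE /= eq_sym.
apply: coef_eq0 => w; apply/eqP; apply: contraT => fw.
have wd := coef_std_comp (fd d) fw.
have := congr1 (coef (eps w)) sum0; rewrite raddf0 raddf_sum.
rewrite (bigD1 (Ordinal dm)) //= big1 ?addr0 => [/eqP|i].
  by rewrite (negPf fw).
rewrite -val_eqE /= => id; apply/eqP; apply: contraNT id => fiw.
by rewrite -wd (coef_std_comp (fd i) fiw).
Qed.

Lemma coef_gM i x w : coef (eps (i :: w)) (x * g i) = coef (eps w) x.
Proof.
have [s ->] := mon_span x; rewrite mulr_suml !raddf_sum; apply: eq_bigr => t _ /=.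
by rewrite -mulrA [_ * g i]mulrC -mon_cons !coef_mon !eps_weq weq_cons2.
Qed.

Lemma coef_gM_neq0 i x v : coef (eps v) (x * g i) != 0 -> exists w, weq v (i :: w).
Proof.
have [s ->] := mon_span x; rewrite mulr_suml !raddf_sum => s0.
have /hasP[t st] : has (fun t => coef (eps v) (iota t.1 * mon g t.2 * g i) != 0) s.
  apply: contraNT s0 => /hasPn H; rewrite big_seq big1 // => t /H /=.
  by rewrite negbK => /eqP.
rewrite -mulrA [_ * g i]mulrC -mon_cons !coef_mon !eps_weq.
by case: ifP => [|_]; rewrite ?eqxx // weq_sym; exists t.2.
Qed.

(** Membership in a monomial ideal is tested one monomial at a time, which turns colon ideals into
    statements on words. *)
Lemma lspan_gens (s : seq I) (x : A) : lspan [seq (g i : A^o) | i <- s] x <->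
  forall w, coef (eps w) x != 0 -> exists j w', j \in s /\ weq w (j :: w').
Proof.
split.
  move: x; apply: (@lspan_rect A A^o (fun x => forall w, coef (eps w) x != 0 ->
    exists j w', j \in s /\ weq w (j :: w'))).
  - by move=> w; rewrite raddf0 eqxx.
  - move=> v1 v2 H1 H2 w; rewrite raddfD /=.
    have [v10|v1N _] := eqVneq (coef (eps w) v1) 0; last exact: H1.
    by rewrite v10 add0r; apply: H2.
  - move=> c _ /mapP[i si ->] w /coef_gM_neq0[w' ww'].
    by exists i, w'.
have [ws [_ xE]] := mon_normal_form x => H; rewrite xE.
apply: (lspan_sum (V := A^o)) => w _.
have [->|/H[j [w' [sj /mon_weq->]]]] := eqVneq (coef (eps w) x) 0.
  by rewrite rmorph0 mul0r; apply: lspan0.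
rewrite mon_cons mulrCA mulrC; apply: (lspanZ (V := A^o)).
by apply: lspan_mem; apply: map_f.
Qed.

Definition toric_family (s : seq A^o) : Prop :=
  exists sigma, s = [seq (g i : A^o) | i <- fil_gens sigma].

Lemma toric_filtration : koszul_filtration toric_family (std_comp iota g 1).
Proof.
move=> _ [sigma ->]; split; last first.
  by move=> _ /mapP[i _ ->]; apply: std_comp_gen.
move=> L1 z L2 E0; have [s1 [i [s2 [sE L1E zE]]]] := map_split E0.
rewrite -{}L1E -{}zE {E0}.
have s1P := fil_gens_prefix sE.
have Wi : wfil sigma i by rewrite -mem_fil_gens sE mem_cat mem_head orbT.
have colonP w := colon_words lab_mdeg u_surj u_gt0 w Wi.
exists [seq (g i : A^o) | i <- fil_gens (colon_sigma lab u sigma i)].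
  by exists (colon_sigma lab u sigma i).
move=> c; rewrite !lspan_gens; split=> H w.
  rewrite -(coef_gM i) => /H[j [w' [js1 ww']]].
  have [|j' [w2 [Wj' ww2]]] := (colonP w).1.
    by exists j, w'; move: js1; rewrite s1P => /andP[].
  by exists j', w2; rewrite mem_fil_gens.
move=> cgi; have [w' ww'] := coef_gM_neq0 cgi.
move: cgi; have /eqP-> : eps w == eps (i :: w') by rewrite eps_weq.
rewrite coef_gM => /H[j [w2 [Wj w'w2]]].
have [|j' [w3 [Wj' ji ww3]]] := (colonP w').2.
  by exists j, w2; rewrite -mem_fil_gens.
exists j', w3; rewrite s1P Wj' ji; split=> //.
exact: weq_trans ww' ww3.
Qed.

Theorem toric_koszul : koszul iota g.
Proof.
have full i : i \in fil_gens (fun=> n).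
  rewrite mem_fil_gens; have [p ip] := mdeg_gt0_ex (u_gt0 i).
  by apply/existsP; exists p; rewrite ltn_ord.
apply: (koszul_filtration_koszul toric_std_graded toric_filtration full).
by exists (fun=> n).
Qed.

(** * The kernel of a presentation *)

Section Presentation.

Variables (P : comNzRingType) (kap : {rmorphism k -> P}) (Tm : I -> P).
Variables (pi : {rmorphism P -> A}) (J : P -> Prop).
Hypothesis pi_kap : forall c, pi (kap c) = iota c.
Hypothesis pi_Tm : forall i, pi (Tm i) = g i.
Hypothesis P_span : forall f, exists s : seq (k * seq I),
  f = \sum_(t <- s) kap t.1 * mon Tm t.2.
Hypothesis J0 : J 0.
Hypothesis JD : forall x y, J x -> J y -> J (x + y).
Hypothesis JM : forall c x, J x -> J (c * x).
Hypothesis J_exchange : forall i j i' j' p q,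
  lab i' = lab i -> lab j' = lab j ->
  (u i' + U_(p) = u i + U_(q))%MM -> (u j' + U_(q) = u j + U_(p))%MM ->
  J (Tm i * Tm j - Tm i' * Tm j').

Lemma pi_mon w : pi (mon Tm w) = mon g w.
Proof. by rewrite rmorph_prod; apply: eq_bigr => i _; rewrite pi_Tm. Qed.

Lemma J_weq w w' : weq w w' -> J (mon Tm w - mon Tm w').
Proof.
have JN x : J x -> J (- x) by move=> Jx; rewrite -mulN1r; apply: JM.
apply: (weq_connect lab_u_inj lab_mdeg u_surj
  (C := fun w w' => J (mon Tm w - mon Tm w'))).
- by move=> v v' p; rewrite [mon Tm v](perm_big _ p) subrr.
- by move=> v v' /JN; rewrite opprB.
- by move=> v2 v1 v3 H1 H2; rewrite -(subrKA (mon Tm v2)); apply: JD.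
- by move=> i v v' H; rewrite !mon_cons -mulrBr; apply: JM.
- move=> i j i' j' v p q li lj ui uj.
  rewrite !mon_cons !mulrA -mulrBl mulrC; apply: JM.
  exact: J_exchange ui uj.
Qed.

(** The terms whose words are equivalent to the first one all map to multiples of one monomial, so
    their coefficients sum to zero. Modulo [J] their words coincide, hence this class lies in [J];
    removing it shortens [f]. *)
Lemma toric_kernel f : pi f = 0 -> J f.
Proof.
have [s ->] := P_span f.
have [m] := ubnP (size s); elim: m s => // m IH [|[c w] s] sm.
  by rewrite big_nil.
pose same := [pred t : k * seq I | weq t.2 w].
rewrite (bigID same) /=; set f1 := \sum_(t <- _ | _) _.
rewrite rmorphD => pi0.
have f1E : J (f1 - kap (\sum_(t <- (c, w) :: s | same t) t.1) * mon Tm w).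
  rewrite rmorph_sum mulr_suml -sumrB; elim/big_rec: _ => // t x tw Jx.
  by apply: JD => //; rewrite -mulrBr; apply/JM/J_weq.
have sum0 : \sum_(t <- (c, w) :: s | same t) t.1 = 0.
  have := congr1 (coef (eps w)) pi0; rewrite raddf0 raddfD /= => /eqP.
  rewrite ![pi _]rmorph_sum !raddf_sum /= [X in _ + X]big1 ?addr0.
    move=> /eqP H; rewrite -[RHS]H; apply: eq_bigr => t tw.
    by rewrite rmorphM pi_kap pi_mon coef_mon eps_weq tw.
  move=> t tw; rewrite rmorphM pi_kap pi_mon coef_mon eps_weq.
  by rewrite (negPf tw).
have Jf1 : J f1.
  by move: f1E; rewrite sum0 rmorph0 mul0r subr0.
apply: JD => //; rewrite -big_filter; apply: IH.
  rewrite /= weq_refl /=; rewrite ltnS in sm; apply: leq_ltn_trans sm.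
  by rewrite size_filter; apply: leq_trans (count_size _ _) _.
rewrite big_filter; move: pi0.
have -> : pi f1 = 0; last by rewrite add0r.
rewrite rmorph_sum (eq_bigr (fun t : k * seq I => iota t.1 * mon g w)).
  by rewrite -mulr_suml -rmorph_sum sum0 rmorph0 mul0r.
by move=> t tw; rewrite rmorphM pi_kap pi_mon (mon_weq tw).
Qed.

End Presentation.

End ToricRing.

(** * Normality *)

Section AlmostIntegral.

Variable A : idomainType.
Local Notation tofrac := (@FracField.tofrac A).

Lemma fraction_repr (z : {fraction A}) :
  exists p q, q != 0 /\ z * tofrac q = tofrac p.
Proof.
elim/quotW: z => x; exists (frac x).1, (frac x).2.
split; first exact: denom_ratioP.
unlock FracField.tofrac; rewrite -[LHS]FracField.pi_mul; apply/eqmodP => /=.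
rewrite FracField.equivfE /FracField.mulf /=.
rewrite !numden_Ratio ?mulr1 ?oner_neq0 ?denom_ratioP //.
by rewrite mulrC.
Qed.

(** With a monic equation of degree M, high powers of z reduce to powers of exponent at most M,
    whose denominators are cleared by [q ^+ M]; this is the [d]. *)
Lemma integral_almost_integral (z : {fraction A}) (p q : A) :
    integralOver tofrac z -> q != 0 -> z * tofrac q = tofrac p ->
  exists2 d, d != 0 & forall N, exists c, d * p ^+ N = c * q ^+ N.
Proof.
move=> [P Pmonic Pz] qN0 zq; pose M := (size P).-1.
pose good y := exists c, y = tofrac c.
have goodD x y : good x -> good y -> good (x + y).
  by move=> [c ->] [d ->]; exists (c + d); rewrite rmorphD.
have goodM c y : good y -> good (tofrac c * y).
  by move=> [d ->]; exists (c * d); rewrite rmorphM.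
have zM : z ^+ M = \sum_(i < M) tofrac (- P`_i) * z ^+ i.
  have sP : size P = M.+1 by rewrite prednK // lt0n size_poly_eq0 monic_neq0.
  have := rootP Pz; rewrite (@horner_coef_wide _ M.+1) -?sP ?size_poly //.
  rewrite sP big_ord_recr /= coef_map /= -[P`_M]/(lead_coef P) (monicP Pmonic).
  rewrite rmorph1 mul1r addrC => /eqP; rewrite addr_eq0 => /eqP->.
  by rewrite -sumrN; apply: eq_bigr => i _; rewrite coef_map /= rmorphN mulNr.
have goodz N : good (tofrac (q ^+ M) * z ^+ N).
  have [m] := ubnP N; elim: m N => // m IH N; rewrite ltnS => leNm.
  have [leNM|ltMN] := leqP N M.
    exists (q ^+ (M - N) * p ^+ N); rewrite -(subnK leNM) exprD !rmorphM -mulrA.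
    congr (_ * _); first by rewrite subnK.
    by rewrite !rmorphXn -exprMn mulrC zq.
  rewrite -(subnK (ltnW ltMN)) exprD zM mulr_sumr mulr_sumr.
  elim/big_rec: _ => [|i y _ gy]; first by exists 0; rewrite rmorph0.
  apply: goodD gy.
  have -> : tofrac (q ^+ M) * (z ^+ (N - M) * (tofrac (- P`_i) * z ^+ i)) =
            tofrac (- P`_i) * (tofrac (q ^+ M) * z ^+ (N - M + i)).
    by rewrite exprD; ring.
  by apply/goodM/IH; have := ltn_ord i; lia.
exists (q ^+ M) => [|N]; first exact: expf_neq0.
have [c cE] := goodz N; exists c; apply/eqP; rewrite -tofrac_eq.
by apply/eqP; rewrite !tofracM -cE -mulrA (tofracXn N p) -zq exprMn (tofracXn N q).
Qed.

Lemma normal_domain_cic :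
    (forall p q d : A, q != 0 -> d != 0 ->
      (forall N, exists c, d * p ^+ N = c * q ^+ N) -> exists x, p = x * q) ->
  normal_domain A.
Proof.
move=> cic z z_int; have [p [q [qN0 zq]]] := fraction_repr z.
have [d dN0 dP] := integral_almost_integral z_int qN0 zq.
have [x pE] := cic p q d qN0 dN0 dP; exists x.
by apply: (mulIf (x := tofrac q)); rewrite ?tofrac_eq0 // zq pE rmorphM.
Qed.

End AlmostIntegral.

Lemma mlead_sub_cancel n (R : idomainType) (p q y : {mpoly R[n]}) :
    q != 0 -> y != 0 -> (mlead y + mlead q)%MM = mlead p ->
  (mlead (p - y * q) < mlead p)%O \/
  mlead (p - y * q) = mlead p /\
    (p - y * q)@_(mlead p) = mleadc p - mleadc y * mleadc q.
Proof.
move=> qN0 yN0 lead_p.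
have lead_yq : mlead (y * q) = mlead p by rewrite mleadM.
have := mleadB_le p (y * q); rewrite lead_yq joinxx le_eqVlt.
move=> /orP[/eqP e|lt_p]; [right|by left].
by split=> //; rewrite mcoeffB -mleadcM lead_p.
Qed.

(** * Division by leading monomials in a monomial subring *)

Section MonomialSubring.

Variables (k : fieldType) (n r : nat) (A : idomainType).
Local Notation R := {mpoly k[n]}.
Local Notation Rt := {mpoly {mpoly k[n]}[r]}.
Variables (v : {rmorphism A -> Rt}) (H : 'X_{1..n} -> 'X_{1..r} -> Prop).
Hypothesis v_inj : injective v.
Hypothesis v_supp : forall x c m, (v x)@_c@_m != 0 -> H m c.
Hypothesis v_mon : forall m c a, H m c ->
  exists x, v x = (a *: 'X_[m])%:MP * 'X_[c].
Hypothesis H_sat : forall pm pc qm qc dm dc, H pm pc -> H qm qc -> H dm dc ->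
  (forall N, exists em ec, [/\ H em ec, (em + qm *+ N = dm + pm *+ N)%MM
                             & (ec + qc *+ N = dc + pc *+ N)%MM]) ->
  exists em ec, [/\ H em ec, (em + qm = pm)%MM & (ec + qc = pc)%MM].

(** The order compares t-monomials first; [lead_x] then looks inside the leading coefficient, itself
    a polynomial in x. *)
Definition lead_t (x : A) : 'X_{1..r} := mlead (v x).
Definition lead_x (x : A) : 'X_{1..n} := mlead (mleadc (v x)).

Lemma v_neq0 x : x != 0 -> v x != 0.
Proof. by apply: contra_neq => e; apply: v_inj; rewrite e rmorph0. Qed.

Lemma leadM x y : x != 0 -> y != 0 ->
  lead_t (x * y) = (lead_t x + lead_t y)%MM /\
  lead_x (x * y) = (lead_x x + lead_x y)%MM.
Proof.
move=> /v_neq0 xN0 /v_neq0 yN0; rewrite /lead_x /lead_t rmorphM.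
have lxN0 : mleadc (v x) != 0 by rewrite (mleadc_eq0 (v x)).
have lyN0 : mleadc (v y) != 0 by rewrite (mleadc_eq0 (v y)).
have -> := mleadM_proper (mulf_neq0 lxN0 lyN0).
by rewrite (mleadcM (v x) (v y)); split=> //; apply: (mleadM lxN0 lyN0).
Qed.

Lemma leadX x N : x != 0 ->
  lead_t (x ^+ N) = (lead_t x *+ N)%MM /\ lead_x (x ^+ N) = (lead_x x *+ N)%MM.
Proof.
move=> xN0; elim: N => [|N [IHt IHx]].
  by rewrite expr0 /lead_x /lead_t rmorph1 mlead1 mcoeff1 eqxx mlead1 !mulm0n.
rewrite exprS; have [-> ->] := leadM xN0 (expf_neq0 N xN0).
by rewrite IHt IHx !mulmS.
Qed.

Lemma lead_H x : x != 0 -> H (lead_x x) (lead_t x).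
Proof.
by move=> xN0; apply: (v_supp (x := x)); rewrite !mleadc_eq0 v_neq0.
Qed.

(** In the binomial expansion each term contains [d * p ^+ (N - i)], divisible by [q ^+ (N - i)],
    and the missing [q ^+ i]. *)
Lemma almost_integral_sub (p q d y : A) :
    (forall N, exists c, d * p ^+ N = c * q ^+ N) ->
  forall N, exists c, d * (p - y * q) ^+ N = c * q ^+ N.
Proof.
move=> pq N; rewrite exprBn mulr_sumr.
pose good x := exists c, x = c * q ^+ N.
rewrite -/(good _); elim/big_rec: _ => [|i x _ [c ->]].
  by exists 0; rewrite mul0r.
have [c' c'E] := pq (N - i)%N.
have iN : (i <= N)%N by rewrite -ltnS ltn_ord.
exists ((-1) ^+ i * c' * y ^+ i *+ 'C(N, i) + c); rewrite mulrDl; congr (_ + _).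
rewrite mulrnAr mulrnAl; congr (_ *+ _).
have qE : q ^+ N = q ^+ (N - i) * q ^+ i by rewrite -exprD subnK.
rewrite exprMn qE.
have -> : d * ((-1) ^+ i * p ^+ (N - i) * (y ^+ i * q ^+ i)) =
          (-1) ^+ i * (d * p ^+ (N - i)) * y ^+ i * q ^+ i by ring.
by rewrite c'E; ring.
Qed.

(* Division algorithm on leading monomials: comparing the leading monomials   *)
(* of [d * p ^+ N = c * q ^+ N] for all [N] shows that the one of [q] divides *)
(* the one of [p] inside the monoid [H].                                      *)
Lemma monomial_subring_cic (p q d : A) : q != 0 -> d != 0 ->
  (forall N, exists c, d * p ^+ N = c * q ^+ N) -> exists x, p = x * q.
Proof.
move=> qN0 dN0; move: {2}(lead_t p) (erefl (lead_t p)) => C.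
elim/(@ltmwf r): C p => C IHC p; move: {2}(lead_x p) (erefl (lead_x p)) => M.
elim/(@ltmwf n): M p => M IHM p leadM_p leadC_p pq.
have [->|pN0] := eqVneq p 0; first by exists 0; rewrite mul0r.
have [em [ec [Hem e_m e_c]]] : exists em ec,
    [/\ H em ec, (em + lead_x q = lead_x p)%MM & (ec + lead_t q = lead_t p)%MM].
  apply: (@H_sat _ _ _ _ (lead_x d) (lead_t d)); try exact: lead_H.
  move=> N; have [c cE] := pq N.
  have cN0 : c != 0.
    apply: contra_neq (mulf_neq0 dN0 (expf_neq0 N pN0)) => c0.
    by rewrite cE c0 mul0r.
  exists (lead_x c), (lead_t c).
  have [<- <-] := leadX N qN0; have [<- <-] := leadX N pN0.
  have [<- <-] := leadM cN0 (expf_neq0 N qN0).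
  have [<- <-] := leadM dN0 (expf_neq0 N pN0).
  by rewrite cE; split=> //; apply: lead_H.
pose pl := mleadc (v p); pose ql := mleadc (v q).
have plN0 : pl != 0 by rewrite mleadc_eq0 v_neq0.
have qlN0 : ql != 0 by rewrite mleadc_eq0 v_neq0.
(* This scalar makes [y * q] and [p] share their leading term, in t and then in x. *)
pose a := mleadc pl / mleadc ql.
have aN0 : a != 0 by apply: mulf_neq0; rewrite ?invr_eq0 mleadc_eq0.
have [y vy] := v_mon a Hem.
have ylN0 : a *: 'X_[em] != 0 :> R.
  by rewrite -mleadc_eq0 mleadZ // mleadXm mcoeffZ mcoeffX eqxx mulr1.
have vyE : v y = a *: 'X_[em] *: 'X_[ec] by rewrite vy mul_mpolyC.
have lead_y : mlead (v y) = ec by rewrite vyE mleadZ // mleadXm.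
have leadc_y : mleadc (v y) = a *: 'X_[em].
  by rewrite lead_y vyE mcoeffZ mcoeffX eqxx mulr1.
have vyN0 : v y != 0 by rewrite -mleadc_eq0 leadc_y.
suff [x xE] : exists x, p - y * q = x * q.
  by exists (x + y); rewrite mulrDl -xE subrK.
have pq' := almost_integral_sub y pq.
have [|lt_t|[eq_t coef_t]] :=
  @mlead_sub_cancel _ _ (v p) (v q) (v y) (v_neq0 qN0) vyN0.
- by rewrite lead_y.
- by apply: (IHC (lead_t (p - y * q))); rewrite // -leadC_p /lead_t rmorphB rmorphM.
rewrite -rmorphM -rmorphB in eq_t coef_t.
have lead_pyq : mleadc (v (p - y * q)) = pl - a *: 'X_[em] * ql.
  by rewrite eq_t coef_t leadc_y.
have [|lt_x|[eq_x coef_x]] := @mlead_sub_cancel _ _ pl ql (a *: 'X_[em]) qlN0 ylN0.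
- by rewrite mleadZ // mleadXm.
- apply: (IHM (lead_x (p - y * q))); rewrite // -?leadM_p -?leadC_p //.
  by rewrite /lead_x lead_pyq.
(* Neither leading monomial has dropped, yet the leading scalars cancel; only the zero polynomial
   has leading coefficient zero. *)
have : p - y * q = 0.
  apply: v_inj; rewrite rmorph0; apply/eqP.
  rewrite -mleadc_eq0 lead_pyq -mleadc_eq0 eq_x coef_x mleadZ // mleadXm.
  have ->: pl@_(mlead pl) = a * ql@_(mlead ql) by rewrite /a divfK // mleadc_eq0.
  by rewrite mcoeffZ mcoeffX eqxx mulr1 subrr.
by move=> ->; exists 0; rewrite mul0r.
Qed.

Lemma monomial_subring_normal : normal_domain A.
Proof. exact/normal_domain_cic/monomial_subring_cic. Qed.

End MonomialSubring.

(** * Monomial subalgebras of k[x][t] *)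

Section MonomialAlgebra.

Variables (k : fieldType) (n r : nat) (I : finType) (lab : I -> nat).
Variables (u : I -> 'X_{1..n}) (aN : nat -> nat) (has0 : bool).
Local Notation R := {mpoly k[n]}.
Local Notation Rt := {mpoly {mpoly k[n]}[r]}.

(* Label [0] is reserved for the variables [x_i], present in the Rees algebra *)
(* but not in the fiber; label [l.+1] carries the variable [t_l].             *)
Definition lab_ok (s : nat) : bool := (s <= r)%N && ((0 < s)%N || has0).

Hypothesis n_gt0 : (0 < n)%N.
Hypothesis aN_gt0 : forall s, (0 < aN s)%N.
Hypothesis aN0 : aN 0 = 1%N.
Hypothesis lab_okP : forall i, lab_ok (lab i).
Hypothesis u_mdeg : forall i, mdeg (u i) = aN (lab i).
Hypothesis lab_u_inj : forall i j, lab i = lab j -> u i = u j -> i = j.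
Hypothesis lab_u_surj : forall s m, lab_ok s -> mdeg m = aN s ->
  exists i, lab i = s /\ u i = m.

Local Notation usum := (usum u).
Local Notation weq := (weq lab u).

Lemma lab_mdeg i j : lab i = lab j -> mdeg (u i) = mdeg (u j).
Proof. by rewrite !u_mdeg => ->. Qed.

Lemma u_surj i m : mdeg m = mdeg (u i) -> exists j, lab j = lab i /\ u j = m.
Proof. by rewrite u_mdeg; apply: lab_u_surj. Qed.

Lemma u_gt0 i : (0 < mdeg (u i))%N.
Proof. by rewrite u_mdeg. Qed.

Definition tdeg (i : I) : 'X_{1..r} := [multinom (lab i == l.+1 : nat) | l < r].

Definition tsum (w : seq I) : 'X_{1..r} := (\sum_(i <- w) tdeg i)%MM.

Definition twt (c : 'X_{1..r}) : nat := (\sum_(l < r) c l * aN l.+1)%N.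

Lemma tsumE w l : tsum w l = count_mem l.+1 (map lab w).
Proof.
rewrite /tsum; elim: w => [|i w IH]; first by rewrite big_nil mnm0E.
by rewrite big_cons mnmDE IH mnmE.
Qed.

(** The excess of the x-degree over the t-weight counts the letters of label 0, which [tsum] does
    not see; [weq_exponents] recovers them this way. *)
Lemma mdeg_usum w :
  mdeg (usum w) = (count_mem 0%N (map lab w) + twt (tsum w))%N.
Proof.
rewrite /twt; elim: w => [|i w IH].
  by rewrite /usum big_nil mdeg0 big1 // => l _; rewrite tsumE.
rewrite usum_cons mdegD IH u_mdeg /=.
have -> : (\sum_(l < r) tsum (i :: w) l * aN l.+1 =
   \sum_(l < r) (lab i == l.+1) * aN l.+1 + \sum_(l < r) tsum w l * aN l.+1)%N.
  by rewrite -big_split; apply: eq_bigr => l _ /=; rewrite !tsumE /= mulnDl.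
have -> : aN (lab i) = ((lab i == 0) + \sum_(l < r) (lab i == l.+1) * aN l.+1)%N.
  move: (lab_okP i); rewrite /lab_ok; case: (lab i) => [|s] /andP[sr _].
    by rewrite aN0 big1.
  rewrite (bigD1 (Ordinal sr)) //= eqxx mul1n big1 ?addn0 // => l.
  by rewrite -val_eqE /= eqSS eq_sym => /negPf->.
by rewrite addnACA.
Qed.

Definition in_cone (m : 'X_{1..n}) (c : 'X_{1..r}) : bool :=
  if has0 then (twt c <= mdeg m)%N else mdeg m == twt c.

Lemma in_cone_word w : in_cone (usum w) (tsum w).
Proof.
rewrite /in_cone mdeg_usum; case: ifP => [_|no0]; first exact: leq_addl.
rewrite -{2}[twt _]add0n eqn_add2r -leqn0 leqNgt -has_count.
apply/hasPn => _ /mapP[i _ ->]; move: (lab_okP i); rewrite /lab_ok no0 orbF.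
by move=> /andP[_]; rewrite lt0n.
Qed.

Lemma word_labels (s : seq nat) m : all lab_ok s ->
  mdeg m = (\sum_(x <- s) aN x)%N -> exists w, map lab w = s /\ usum w = m.
Proof.
move=> s_ok md; have [w0 lw0] : exists w0, map lab w0 = s.
  elim: s s_ok {md} => [|x s IH] /=; first by exists [::].
  move=> /andP[x_ok /IH[w <-]].
  have [|i [<- _]] := @lab_u_surj x (U_(Ordinal n_gt0) *+ aN x)%MM x_ok.
    by rewrite mdegMn mdeg1 mul1n.
  by exists (i :: w).
have [|w [lw uw]] := @word_realize _ _ _ _ u_surj w0 m; last first.
  by exists w; rewrite lw.
rewrite md -lw0 big_map /usum mdeg_sum; apply: eq_bigr => i _.
by rewrite u_mdeg.
Qed.

Lemma in_coneP m c : in_cone m c -> exists w, usum w = m /\ tsum w = c.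
Proof.
move=> Hmc; pose s := nseq (mdeg m - twt c) 0%N ++
  flatten [seq nseq (c l) l.+1 | l <- enum 'I_r].
have [||w [lw uw]] := @word_labels s m.
- rewrite all_cat all_nseq; apply/andP; split.
    move: Hmc; rewrite /in_cone /lab_ok; case: has0 => [_|/eqP->].
      by rewrite /= !orbT.
    by rewrite subnn.
  apply/allP => x /flattenP[_ /mapP[l _ ->]] /nseqP[-> _].
  by rewrite /lab_ok ltn_ord.
- rewrite big_cat /= big_nseq iter_addn addn0 aN0 mul1n.
  rewrite big_flatten /= big_map big_enum.
  rewrite (eq_bigr (fun l : 'I_r => (c l * aN l.+1)%N)) => [|l _].
    rewrite -/(twt c) subnK //; move: Hmc; rewrite /in_cone.
    by case: has0 => // /eqP->.
  by rewrite big_nseq iter_addn addn0 mulnC.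
exists w; split=> //; apply/mnmP => l; rewrite tsumE lw count_cat count_nseq mul0n.
rewrite count_flatten sumnE big_map big_map big_enum /= (bigD1 l) //=.
rewrite count_nseq /= eqxx mul1n.
by rewrite big1 ?addn0 // => l' /negPf nl; rewrite count_nseq /= eqSS val_eqE nl.
Qed.

Lemma weq_exponents w w' :
  ((usum w, tsum w) == (usum w', tsum w')) = weq w w'.
Proof.
rewrite /weq xpair_eqE andbC; apply/andP/andP => [[/eqP et /eqP eu]|[pl /eqP eu]].
  split; last by rewrite eu.
  have e l : count_mem l.+1 (map lab w) = count_mem l.+1 (map lab w') \/ (r <= l)%N.
    have [lr|] := ltnP l r; last by right.
    by left; rewrite -(tsumE _ (Ordinal lr)) -(tsumE w' (Ordinal lr)) et.
  apply/allP => x; have [->|] := posnP x.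
    have := mdeg_usum w; rewrite eu mdeg_usum et => /eqP.
    by rewrite eqn_add2r eq_sym.
  case: x => // x _; have [ex|rx] := e x; first by rewrite /= ex eqxx.
  rewrite mem_cat => /orP[] /mapP[i _ ex]; move: (lab_okP i); rewrite /lab_ok -ex;
    by rewrite ltnNge rx.
split; last by rewrite eu.
by apply/eqP/mnmP => l; rewrite !tsumE; move/permP: pl => ->.
Qed.

(** The conditions are linear: a deficit would be multiplied by N, while the contribution of d is
    fixed, so N one above that contribution rules it out. *)
Lemma in_cone_saturated pm pc qm qc dm dc :
    in_cone pm pc -> in_cone qm qc -> in_cone dm dc ->
    (forall N, exists em ec, [/\ in_cone em ec, (em + qm *+ N = dm + pm *+ N)%MM
                               & (ec + qc *+ N = dc + pc *+ N)%MM]) ->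
  exists em ec, [/\ in_cone em ec, (em + qm = pm)%MM & (ec + qc = pc)%MM].
Proof.
move=> Hp Hq Hd HN.
have qpm : (qm <= pm)%MM.
  apply/mnm_lepP => i; have [em [ec [_ /mnmP/(_ i) e _]]] := HN (dm i).+1.
  by move: e; rewrite !mnmDE !mulmnE; nia.
have qpc : (qc <= pc)%MM.
  apply/mnm_lepP => i; have [em [ec [_ _ /mnmP/(_ i) e]]] := HN (dc i).+1.
  by move: e; rewrite !mnmDE !mulmnE; nia.
have twtD c c' : twt (c + c')%MM = (twt c + twt c')%N.
  by rewrite -big_split; apply: eq_bigr => l _ /=; rewrite mnmDE mulnDl.
have twtMn c N : twt (c *+ N)%MM = (twt c * N)%N.
  by rewrite big_distrl; apply: eq_bigr => l _ /=; rewrite mulmnE mulnAC.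
exists (pm - qm)%MM, (pc - qc)%MM; rewrite !submK //; split=> //.
have em := congr1 mdeg (submK qpm); have ec := congr1 twt (submK qpc).
rewrite mdegD in em; rewrite twtD in ec.
move: Hp Hq Hd HN; rewrite /in_cone; case: has0 => Hp Hq Hd HN; last first.
  by move: Hp Hq => /eqP Hp /eqP Hq; rewrite -(eqn_add2r (mdeg qm)) em Hp Hq ec.
have [em' [ec' [He /(congr1 mdeg) em1 /(congr1 twt) ec1]]] := HN (mdeg dm).+1.
rewrite !mdegD !mdegMn in em1; rewrite !twtD !twtMn in ec1.
nia.
Qed.

Definition rt_gen (i : I) : Rt := 'X_[u i]%:MP * 'X_[tdeg i].

Lemma rt_mon w : mon rt_gen w = 'X_[usum w]%:MP * 'X_[tsum w].
Proof.
elim: w => [|i w IH].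
  by rewrite /mon /usum /tsum !big_nil !mpolyX0 mulr1 rmorph1.
by rewrite mon_cons IH usum_cons /tsum big_cons !mpolyXD /rt_gen rmorphM mulrACA.
Qed.

Variables (A : idomainType) (v : {rmorphism A -> Rt}) (iota : {rmorphism k -> A}).
Variable g : I -> A.
Hypothesis v_inj : injective v.
Hypothesis v_iota : forall c, v (iota c) = c%:MP%:MP.
Hypothesis v_g : forall i, v (g i) = rt_gen i.
Hypothesis A_span : forall x, exists s : seq (k * seq I),
  x = \sum_(t <- s) iota t.1 * mon g t.2.

Lemma v_term c w : v (iota c * mon g w) = (c *: 'X_[usum w])%:MP * 'X_[tsum w].
Proof.
rewrite rmorphM v_iota -mul_mpolyC rmorphM -mulrA -rt_mon; congr (_ * _).
by rewrite rmorph_prod; apply: eq_bigr => i _; rewrite v_g.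
Qed.

Definition rt_coef (e : 'X_{1..n} * 'X_{1..r}) : {additive A -> k} :=
  mcoeff e.1 \o (mcoeff e.2 \o v).

Lemma rt_coef_term e c w : rt_coef e (iota c * mon g w) =
  if (usum w, tsum w) == e then c else 0.
Proof.
case: e => m t; rewrite /rt_coef /= v_term mcoeffCM mcoeffX xpair_eqE.
case: (tsum w == t); last by rewrite mulr0 mcoeff0 andbF.
by rewrite mulr1 mcoeffZ mcoeffX andbT; case: eqP; rewrite ?mulr1 ?mulr0.
Qed.

Lemma rt_mon_weq w w' : weq w w' -> mon g w = mon g w'.
Proof.
move=> ww'; have := weq_exponents w w'; rewrite ww' => /eqP[eu et].
apply: v_inj; have := v_term 1 w; have := v_term 1 w'.
by rewrite !rmorph1 !mul1r eu et => -> ->.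
Qed.

Lemma monomial_algebra_koszul : koszul iota g.
Proof.
exact: (toric_koszul lab_u_inj lab_mdeg u_surj u_gt0 rt_coef_term
  weq_exponents rt_mon_weq A_span).
Qed.

Lemma monomial_algebra_normal : normal_domain A.
Proof.
apply: (@monomial_subring_normal _ _ _ A v in_cone).
- exact: v_inj.
- move=> x c m; have [s ->] := A_span x => s0.
  have /hasP[t _] : has (fun t => rt_coef (m, c) (iota t.1 * mon g t.2) != 0) s.
    apply: contraNT s0 => /hasPn H.
    rewrite rmorph_sum !raddf_sum /= big_seq big1 //=.
    by move=> t /H; rewrite negbK => /eqP.
  rewrite rt_coef_term; case: ifP => [/eqP[<- <-] _|_]; last by rewrite eqxx.
  exact: in_cone_word.
- move=> m c a /in_coneP[w [<- <-]]; exists (iota a * mon g w); exact: v_term.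
- exact: in_cone_saturated.
Qed.

Lemma monomial_algebra_kernel (P : comNzRingType) (kap : {rmorphism k -> P})
    (Tm : I -> P) (pi : {rmorphism P -> A}) (J : P -> Prop) :
    (forall c, pi (kap c) = iota c) -> (forall i, pi (Tm i) = g i) ->
    (forall f, exists s : seq (k * seq I),
      f = \sum_(t <- s) kap t.1 * mon Tm t.2) ->
    J 0 -> (forall x y, J x -> J y -> J (x + y)) ->
    (forall c x, J x -> J (c * x)) ->
    (forall i j i' j' p q, lab i' = lab i -> lab j' = lab j ->
      (u i' + U_(p) = u i + U_(q))%MM -> (u j' + U_(q) = u j + U_(p))%MM ->
      J (Tm i * Tm j - Tm i' * Tm j')) ->
  forall f, pi f = 0 -> J f.
Proof.
move=> pi_kap pi_Tm P_span J0 JD JM J_ex f.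
exact: (toric_kernel lab_u_inj lab_mdeg u_surj rt_coef_term
  weq_exponents rt_mon_weq pi_kap pi_Tm P_span J0 JD JM J_ex).
Qed.

End MonomialAlgebra.

(** * Exchange matrices and multi-indices *)

Section TwoMinors.

Variables (P : comNzRingType) (m p : nat) (X : 'M[P]_(m, p)).
Local Notation J := (minors_ideal 2 X).

Lemma ideal_gen0 (G : P -> Prop) : ideal_gen G 0.
Proof.
by exists 0%N, (fun=> 0), (fun=> 0); split; [case|rewrite big_ord0].
Qed.

Lemma ideal_genD (G : P -> Prop) x y :
  ideal_gen G x -> ideal_gen G y -> ideal_gen G (x + y).
Proof.
move=> [m1 [c1 [g1 [G1 ->]]]] [m2 [c2 [g2 [G2 ->]]]]; exists (m1 + m2)%N.
exists (fun i => match split i with inl j => c1 j | inr j => c2 j end).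
exists (fun i => match split i with inl j => g1 j | inr j => g2 j end).
split=> [i|]; first by case: (split i).
rewrite big_split_ord; congr (_ + _); apply: eq_bigr => i _ /=.
  by rewrite (unsplitK (inl i)).
by rewrite (unsplitK (inr i)).
Qed.

Lemma ideal_genM (G : P -> Prop) c x : ideal_gen G x -> ideal_gen G (c * x).
Proof.
move=> [l [d [g [Gg ->]]]]; exists l, (fun i => c * d i), g; split=> //.
by rewrite mulr_sumr; apply: eq_bigr => i _; rewrite mulrA.
Qed.

Lemma ideal_gen_mem (G : P -> Prop) x : G x -> ideal_gen G x.
Proof. by exists 1%N, (fun=> 1), (fun=> x); rewrite big_ord1 mul1r. Qed.

Lemma det2 (Y : 'M[P]_2) : \det Y = Y 0 0 * Y 1 1 - Y 0 1 * Y 1 0.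
Proof.
rewrite (expand_det_row _ 0) !big_ord_recl big_ord0 addr0 /cofactor.
rewrite !det_mx11 !mxE /=.
rewrite expr0 mul1r expr1 mulN1r mulrN.
by congr (Y _ _ * Y _ _ - Y _ _ * Y _ _); apply: val_inj.
Qed.

Lemma is_minor2P x : is_minor 2 X x <-> exists (s t : 'I_m) (q q' : 'I_p),
  [/\ (s < t)%N, (q < q')%N & x = X s q * X t q' - X s q' * X t q].
Proof.
split=> [[f [h [Hf Hh ->]]]|[s [t [q [q' [st qq' ->]]]]]].
  exists (f 0), (f 1), (h 0), (h 1); rewrite det2 !mxE.
  by split=> //; [apply: Hf|apply: Hh].
exists (fun i => if i == 0 then s else t), (fun i => if i == 0 then q else q').
split; last by rewrite det2 !mxE.
- by move=> [[|[|?]] ?] [[|[|?]] ?].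
- by move=> [[|[|?]] ?] [[|[|?]] ?].
Qed.

(** Minors use increasing rows and columns; another order costs a sign, and a repeated index gives
    0. *)
Lemma minors2_mem s t q q' : J (X s q * X t q' - X t q * X s q').
Proof.
have JN x : J x -> J (- x) by move=> Jx; rewrite -mulN1r; apply: ideal_genM.
have H (a b : 'I_m) (c d : 'I_p) : (a < b)%N -> (c < d)%N ->
      J (X a c * X b d - X a d * X b c).
  by move=> ab cd; apply/ideal_gen_mem/is_minor2P; exists a, b, c, d.
have [st|ts|/val_inj->] := ltngtP s t; last by rewrite subrr; apply: ideal_gen0.
  have [qq|qq|/val_inj->] := ltngtP q q'.
  - by rewrite [X t q * _]mulrC; apply: H.
  - by rewrite -opprB; apply: JN; rewrite [X t q * _]mulrC; apply: H.
  - by rewrite mulrC subrr; apply: ideal_gen0.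
have [qq|qq|/val_inj->] := ltngtP q q'.
- by rewrite -opprB; apply: JN; rewrite [X s q * _]mulrC; apply: H.
- by rewrite [X s q * _]mulrC; apply: H.
- by rewrite mulrC subrr; apply: ideal_gen0.
Qed.

End TwoMinors.

Section ExchangeMatrix.

Variables (n : nat) (I : finType) (lab : I -> nat) (u : I -> 'X_{1..n}).
Hypothesis lab_u_inj : forall i j, lab i = lab j -> u i = u j -> i = j.
Variables (P : comNzRingType) (Tm : I -> P) (p : nat) (X : 'M[P]_(n, p)).

(* Column [q] lists the variables with monomials [x_s * u i / x_t].           *)
Definition exchange_col (i : I) (t : 'I_n) (q : 'I_p) : Prop :=
  forall s, exists i',
    [/\ lab i' = lab i, (u i' + U_(t) = u i + U_(s))%MM & X s q = Tm i'].

Hypothesis col_ex : forall i t, (0 < u i t)%N -> exists q, exchange_col i t q.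
Hypothesis col_all : forall q, exists i t, exchange_col i t q.

(** Take rows s and t of the column through [u i / x_s] and of the one through [u j / x_t]: the
    entries are T_i, T_i' and T_j', T_j. *)
Lemma minors2_exchange i j i' j' s t : lab i' = lab i -> lab j' = lab j ->
  (u i' + U_(s) = u i + U_(t))%MM -> (u j' + U_(t) = u j + U_(s))%MM ->
  minors_ideal 2 X (Tm i * Tm j - Tm i' * Tm j').
Proof.
move=> li lj ui uj; have [st|st] := eqVneq s t.
  have -> : i' = i.
    by apply: lab_u_inj => //; apply: (@addIm _ U_(s)%MM); rewrite ui st.
  have -> : j' = j.
    by apply: lab_u_inj => //; apply: (@addIm _ U_(t)%MM); rewrite uj st.
  by rewrite subrr; apply: ideal_gen0.
have gt0 i0 i1 s0 t0 : s0 != t0 ->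
    (u i1 + U_(s0) = u i0 + U_(t0))%MM -> (0 < u i0 s0)%N.
  move=> /negPf ne /mnmP/(_ s0); rewrite !mnmDE !mnm1E eqxx eq_sym ne; lia.
have [q qP] := col_ex (gt0 _ _ _ _ st ui).
have [q' q'P] := col_ex (gt0 _ _ _ _ (contra_neq esym st) uj).
have colE i0 i1 s0 t0 q0 : exchange_col i0 s0 q0 -> lab i1 = lab i0 ->
    (u i1 + U_(s0) = u i0 + U_(t0))%MM -> X t0 q0 = Tm i1.
  move=> /(_ t0)[i2 [li2 ui2 ->]] li1 ui1; congr Tm; apply: lab_u_inj.
    by rewrite li1 li2.
  by apply: (@addIm _ U_(s0)%MM); rewrite ui1 ui2.
have := minors2_mem X s t q q'.
rewrite (colE i i s s q) // (colE j j t t q') // (colE i i' s t q) //.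
by rewrite (colE j j' t s q').
Qed.

Lemma minors2_kernel (A : comNzRingType) (g : I -> A) (pi : {rmorphism P -> A}) :
    (forall i, pi (Tm i) = g i) ->
    (forall w w', weq lab u w w' -> mon g w = mon g w') ->
  forall f, minors_ideal 2 X f -> pi f = 0.
Proof.
move=> pi_Tm mon_weq f [m [c [h [Hh ->]]]]; rewrite rmorph_sum big1 // => l _.
rewrite rmorphM; have /is_minor2P[s [t [q [q' [_ _ ->]]]]] := Hh l.
suff -> : pi (X s q * X t q' - X s q' * X t q) = 0 by rewrite mulr0.
have [i [x qP]] := col_all q; have [j [y q'P]] := col_all q'.
have [i1 [li1 ui1 ->]] := qP s; have [i2 [li2 ui2 ->]] := qP t.
have [j1 [lj1 uj1 ->]] := q'P s; have [j2 [lj2 uj2 ->]] := q'P t.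
rewrite rmorphB !rmorphM !pi_Tm; apply/eqP; rewrite subr_eq0; apply/eqP.
have := mon_weq [:: i1; j2] [:: i2; j1]; rewrite /mon !big_cons !big_nil !mulr1.
rewrite [g j1 * _]mulrC; apply.
rewrite /weq /= li1 li2 lj1 lj2 perm_refl /= /usum !big_cons !big_nil !addm0.
apply/eqP/mnmP => z; move: ui1 ui2 uj1 uj2.
move=> /mnmP/(_ z) e1 /mnmP/(_ z) e2 /mnmP/(_ z) e3 /mnmP/(_ z).
by move: e1 e2 e3; rewrite !mnmDE; lia.
Qed.

End ExchangeMatrix.

(** * Spanning by words of generators *)

Section Spanned.

Variables (k : fieldType) (P : comNzRingType) (kap : {rmorphism k -> P}).
Variables (I : finType) (Tm : I -> P).

Definition spanned (f : P) : Prop := exists s : seq (k * seq I),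
  f = \sum_(t <- s) kap t.1 * mon Tm t.2.

Lemma spanned0 : spanned 0.
Proof. by exists [::]; rewrite big_nil. Qed.

Lemma spannedD f f' : spanned f -> spanned f' -> spanned (f + f').
Proof. by move=> [s ->] [s' ->]; exists (s ++ s'); rewrite big_cat. Qed.

Lemma spanned_sum (T : Type) (s : seq T) (Q : pred T) (F : T -> P) :
  (forall i, Q i -> spanned (F i)) -> spanned (\sum_(i <- s | Q i) F i).
Proof.
move=> H; elim/big_rec: _ => [|i f Qi sf]; first exact: spanned0.
by apply: spannedD => //; apply: H.
Qed.

Lemma spanned_term c w : spanned (kap c * mon Tm w).
Proof. by exists [:: (c, w)]; rewrite big_seq1. Qed.

Lemma spannedM f f' : spanned f -> spanned f' -> spanned (f * f').
Proof.
move=> [s ->] [s' ->]; rewrite mulr_suml; apply: spanned_sum => t _.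
rewrite mulr_sumr; apply: spanned_sum => t' _.
by rewrite mulrACA -rmorphM -mon_cat; apply: spanned_term.
Qed.

Lemma spanned_const c : spanned (kap c).
Proof. by have := spanned_term c [::]; rewrite /mon big_nil mulr1. Qed.

Lemma spanned_gen i : spanned (Tm i).
Proof.
by have := spanned_term 1 [:: i]; rewrite /mon big_seq1 rmorph1 mul1r.
Qed.

Lemma spanned_mpoly (B : comNzRingType) m (h : {rmorphism {mpoly B[m]} -> P}) :
    (forall b, spanned (h b%:MP)) -> (forall i, spanned (h 'X_i)) ->
  forall f, spanned (h f).
Proof.
have s1 : spanned 1 by rewrite -(rmorph1 kap); apply: spanned_const.
move=> hC hX f; rewrite [f]mpolyE rmorph_sum; apply: spanned_sum => e _.
rewrite -mul_mpolyC rmorphM; apply: spannedM => //.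
rewrite mpolyXE_id rmorph_prod; elim/big_rec: _ => // i x _ sx.
apply: spannedM => //; rewrite rmorphXn.
by elim: (e i) => [|d IH]; rewrite ?expr0 // exprS; apply: spannedM.
Qed.

Lemma spanned_surj (A : comNzRingType) (iota : {rmorphism k -> A}) (g : I -> A)
    (pi : {rmorphism P -> A}) (y : A) :
    (forall c, pi (kap c) = iota c) -> (forall i, pi (Tm i) = g i) ->
    (exists s : seq (k * seq I), y = \sum_(t <- s) iota t.1 * mon g t.2) ->
  exists f, pi f = y.
Proof.
move=> pi_kap pi_Tm [s ->]; exists (\sum_(t <- s) kap t.1 * mon Tm t.2).
rewrite rmorph_sum; apply: eq_bigr => t _; rewrite rmorphM pi_kap rmorph_prod.
by congr (_ * _); apply: eq_bigr => i _; rewrite pi_Tm.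
Qed.

End Spanned.

(** * Multi-indices as monomials of degree a *)

Section MultiIndexMonomials.

Variables (n a : nat).
Hypothesis n_gt0 : (0 < n)%N.
Implicit Types j : mindex n a.

Definition jmon j : 'X_{1..n} := [multinom (ji j i.+1 - ji j i)%N | i < n].

Lemma ji0 j : ji j 0 = 0%N.
Proof. by []. Qed.

Lemma ji_last j s : (n <= s)%N -> ji j s = a.
Proof. by move=> ns; rewrite /ji nth_default //= size_map size_tuple prednK. Qed.

Lemma jiS j s (lt_s : (s < n.-1)%N) : ji j s.+1 = tnth (val j) (Ordinal lt_s).
Proof.
rewrite /ji /= (nth_map ord0) ?size_tuple //; congr (nat_of_ord _).
exact/esym/(tnth_nth ord0 (val j) (Ordinal lt_s)).
Qed.

Lemma ji_le j s : (ji j s <= a)%N.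
Proof.
have [ns|] := leqP n s; first by rewrite ji_last.
case: s => [|s] sn; first by rewrite ji0.
have lt_s : (s < n.-1)%N by rewrite -ltnS prednK.
by rewrite (jiS _ lt_s) -ltnS.
Qed.

Lemma ji_mono j s : (ji j s <= ji j s.+1)%N.
Proof.
have [ns|sn] := leqP n s.+1; first by rewrite (ji_last j ns) ji_le.
case: s sn => [|s] sn; first by rewrite ji0.
move: (valP j) => /(sortedP a)/(_ s); apply.
by rewrite size_map size_tuple -ltnS prednK.
Qed.

Lemma jmonE j (i : 'I_n) : (ji j i + jmon j i)%N = ji j i.+1.
Proof. by rewrite mnmE subnKC // ji_mono. Qed.

Lemma mdeg_jmon j : mdeg (jmon j) = a.
Proof.
rewrite mdegE; suff H s : (s <= n)%N -> (\sum_(i < n | i < s) jmon j i = ji j s)%N.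
  rewrite -[RHS](ji_last j (leqnn n)) -H //; apply: eq_bigl => i.
  by rewrite ltn_ord.
elim: s => [|s IH] sn; first by rewrite big_pred0.
rewrite (bigD1 (Ordinal sn)) //= addnC -(jmonE _ (Ordinal sn)) -IH ?(ltnW sn) //.
congr (_ + _)%N; apply: eq_bigl => i; rewrite -val_eqE /= ltnS.
by rewrite ltn_neqAle andbC.
Qed.

Lemma mindex_eq j j' : (forall s, ji j s = ji j' s) -> j = j'.
Proof.
move=> jj'; apply/val_inj/eq_from_tnth => i; apply: val_inj.
have := jj' i.+1; rewrite !(jiS _ (ltn_ord i)) /=.
by have -> : Ordinal (ltn_ord i) = i by apply: val_inj.
Qed.

Lemma jmon_inj : injective jmon.
Proof.
move=> j j' /mnmP jj'; apply: mindex_eq => s.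
have [ns|sn] := leqP n s; first by rewrite !ji_last.
elim: s sn => // s IH sn; rewrite -!(jmonE _ (Ordinal (ltnW sn))) /= IH ?jj' //.
exact: ltnW.
Qed.

Lemma ji_ext j (F : nat -> nat) : F 0 = 0%N -> (forall s, (n <= s)%N -> F s = a) ->
  (forall i : 'I_n.-1, tnth (val j) i = F i.+1 :> nat) -> forall s, ji j s = F s.
Proof.
move=> F0 Fn Fi s; have [ns|] := leqP n s; first by rewrite ji_last ?Fn.
case: s => [|s] sn; first by rewrite ji0 F0.
have lt_s : (s < n.-1)%N by rewrite -ltnS prednK.
by rewrite (jiS _ lt_s) Fi.
Qed.

Lemma jmon_surj m : mdeg m = a -> exists j, jmon j = m.
Proof.
(* The inverse of [jmon]: j_s is the sum of the first s exponents. *)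
move=> md; pose F s := (\sum_(i < n | i < s) m i)%N.
have Fa s : (F s <= a)%N.
  by rewrite -md mdegE /F big_mkcond; apply: leq_sum => i _; case: ifP.
have FS (i : 'I_n) : F i.+1 = (F i + m i)%N.
  rewrite /F (bigD1 i) //= addnC; congr (_ + _)%N; apply: eq_bigl => i'.
  by rewrite -val_eqE /= ltnS ltn_neqAle andbC.
have Fn s : (n <= s)%N -> F s = a.
  move=> ns; rewrite -md mdegE; apply: eq_bigl => i.
  by rewrite (leq_trans (ltn_ord i)).
pose t : n.-1.-tuple 'I_a.+1 := [tuple inord (F i.+1) | i < n.-1].
have tE i : tnth t i = F i.+1 :> nat by rewrite tnth_mktuple inordK // ltnS.
have t_sorted : sorted leq (map val t).
  apply/(sortedP 0%N) => i; rewrite size_map size_tuple => lt_i.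
  rewrite !(nth_map ord0) ?size_tuple ?(ltnW lt_i) //.
  rewrite -(tnth_nth ord0 t (Ordinal lt_i)) -(tnth_nth ord0 t (Ordinal (ltnW lt_i))).
  rewrite /= !tE /= (FS (Ordinal (leq_trans lt_i (leq_pred n)))) /=.
  exact: leq_addr.
exists (MIndex t_sorted); apply/mnmP => i; rewrite mnmE.
by rewrite !(@ji_ext (MIndex t_sorted) F) ?FS ?addKn //; apply: big_pred0.
Qed.

(** Subtracting 1 from j_1, ..., j_s takes one factor x_1 away and adds one factor x_(s+1), so a
    column of B is an exchange column through x_1. *)
Lemma jmon_lower j (s z : 'I_n) : z = 0%N :> nat -> (0 < ji j 1)%N ->
  (jmon (lower j s.+1) + U_(z) = jmon j + U_(s))%MM.
Proof.
move=> z0 j1; have lowE t : ji (lower j s.+1) t = (ji j t - (0 < t < s.+1))%N.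
  apply: (@ji_ext _ (fun t => ji j t - (0 < t < s.+1))%N) => [|x nx|i].
  - by rewrite ji0.
  - by rewrite ji_last // [(x < _)%N]ltnNge (leq_trans (ltn_ord s) nx) andbF subn0.
  - rewrite tnth_mktuple inordK.
      by rewrite (jiS _ (ltn_ord i)) /=; congr (nat_of_ord (tnth _ _) - _)%N;
        apply: val_inj.
    by rewrite ltnS (leq_trans (leq_subr _ _)) // -ltnS ltn_ord.
have ji_gt0 t : (0 < t)%N -> (0 < ji j t)%N.
  by elim: t => // -[//|t] IH _; apply: leq_trans (IH _) (ji_mono _ _).
apply/mnmP => t; rewrite !mnmDE !mnmE !lowE -!val_eqE /= z0.
have := ji_mono j t; have := ji_gt0 t; have := ji_gt0 t.+1 isT.
have := ji0 j; case: (nat_of_ord t) => [|x]; lia.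
Qed.

End MultiIndexMonomials.

(** * The Rees algebra and the special fiber ring *)

Section SpannedImage.

Variables (k : fieldType) (P Q : comNzRingType) (kap : {rmorphism k -> P}).
Variables (I : finType) (Tm : I -> P) (h : {rmorphism P -> Q}).

Lemma spanned_inj (kap' : {rmorphism k -> Q}) (Tm' : I -> Q) f :
    injective h ->
    (forall c, h (kap c) = kap' c) -> (forall i, h (Tm i) = Tm' i) ->
  spanned kap' Tm' (h f) -> spanned kap Tm f.
Proof.
move=> h_inj h_kap h_Tm [s sE]; exists s; apply: h_inj; rewrite sE rmorph_sum.
apply: eq_bigr => t _; rewrite rmorphM h_kap rmorph_prod; congr (_ * _).
by apply: eq_bigr => i _; rewrite h_Tm.
Qed.

End SpannedImage.

Lemma subalg_gen_spanned (B D : comNzRingType) (iota : {rmorphism B -> D})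
    (G : D -> Prop) (k : fieldType) (kap : {rmorphism k -> D})
    (I : finType) (Tm : I -> D) x :
    (forall b, spanned kap Tm (iota b)) ->
    (forall y, G y -> spanned kap Tm y) ->
  subalg_gen iota G x -> spanned kap Tm x.
Proof.
move=> sB sG; elim=> {x} [b|x /sG //|x y _ sx _ sy|x y _ sx _ sy] //.
- exact: spannedD.
- exact: spannedM.
Qed.

(** * Generators and matrices of the two algebras *)

Section Columns.

Variables (k : fieldType) (n r : nat) (a : 'I_r -> nat).
Hypothesis n_gt0 : (0 < n)%N.
Hypothesis a_gt0 : forall l, (1 <= a l)%N.
Local Notation colidx := (colidx n a).
Local Notation R := {mpoly k[n]}.
Local Notation Rt := {mpoly {mpoly k[n]}[r]}.
Local Notation T := {mpoly k[#|{: colidx}|]}.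
Local Notation S := {mpoly T[n]}.

Definition col_lab (c : colidx) : nat := (tag c).+1.
Definition col_u (c : colidx) : 'X_{1..n} := jmon (tagged c).

Definition gen_lab (v : 'I_n + colidx) : nat :=
  match v with inl _ => 0 | inr c => col_lab c end.
Definition gen_u (v : 'I_n + colidx) : 'X_{1..n} :=
  match v with inl i => U_(i)%MM | inr c => col_u c end.

(** Label 0 has degree 1 as it carries the x_i; the default 1 out of range keeps all degrees
    positive. *)
Definition lab_deg (s : nat) : nat :=
  if s is s'.+1 then (if insub s' is Some l then a l else 1) else 1.

Lemma lab_deg_gt0 s : (0 < lab_deg s)%N.
Proof. by case: s => [|s] //=; case: insub. Qed.

Lemma lab_degS (l : 'I_r) : lab_deg l.+1 = a l.
Proof. by rewrite /= valK. Qed.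

Lemma col_u_mdeg c : mdeg (col_u c) = lab_deg (col_lab c).
Proof. by rewrite mdeg_jmon // lab_degS. Qed.

Lemma col_inj c c' : col_lab c = col_lab c' -> col_u c = col_u c' -> c = c'.
Proof.
case: c c' => [l j] [l' j'] [/val_inj ll]; rewrite /= in ll; subst l'.
by rewrite /col_u /= => /(jmon_inj n_gt0)->.
Qed.

Lemma col_surj (l : 'I_r) m : mdeg m = a l ->
  exists c : colidx, tag c = l /\ col_u c = m.
Proof.
by move=> /(jmon_surj n_gt0)[j <-]; exists (Tagged (fun l => mindex n (a l)) j).
Qed.

Lemma col_lab_ok c : lab_ok r false (col_lab c).
Proof. by rewrite /lab_ok ltn_ord. Qed.

Lemma col_lab_surj s m : lab_ok r false s -> mdeg m = lab_deg s ->
  exists c, col_lab c = s /\ col_u c = m.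
Proof.
rewrite /lab_ok orbF; case: s => [|s] /andP[sr //= _].
rewrite -[s]/(val (Ordinal sr)) valK => /col_surj[c [ct cu]].
by exists c; rewrite /col_lab ct.
Qed.

Lemma gen_lab_ok v : lab_ok r true (gen_lab v).
Proof. by case: v => [i|c]; rewrite /lab_ok //= ltn_ord. Qed.

Lemma gen_u_mdeg v : mdeg (gen_u v) = lab_deg (gen_lab v).
Proof. by case: v => [i|c]; rewrite ?mdeg1 ?col_u_mdeg. Qed.

Lemma gen_inj v v' : gen_lab v = gen_lab v' -> gen_u v = gen_u v' -> v = v'.
Proof.
case: v v' => [i|c] [i'|c'] //= e.
  by move=> /eqP; rewrite eq_mnm1 => /eqP->.
by move=> /(col_inj e)->.
Qed.

Lemma gen_lab_surj s m : lab_ok r true s -> mdeg m = lab_deg s ->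
  exists v, gen_lab v = s /\ gen_u v = m.
Proof.
case: s => [_ /eqP|s s_ok].
  by move=> /mdeg1P[i /eqP->]; exists (inl i).
have s_ok' : lab_ok r false s.+1 by move: s_ok; rewrite /lab_ok.
by move=> /(col_lab_surj s_ok')[c [<- <-]]; exists (inr c).
Qed.

Lemma xmonE c : xmon k c = 'X_[col_u c].
Proof. by rewrite mpolyXE_id; apply: eq_bigr => i _; rewrite mnmE. Qed.

Lemma tdeg_col c : tdeg r col_lab c = U_(tag c)%MM.
Proof. by apply/mnmP => l. Qed.

Lemma xt_col c : xt k c = rt_gen k r col_lab col_u c.
Proof. by rewrite /xt /rt_gen xmonE tdeg_col. Qed.

Lemma xt_gen c : xt k c = rt_gen k r gen_lab gen_u (inr c).
Proof. by rewrite xt_col. Qed.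

Lemma x_gen i : ('X_i : R)%:MP = rt_gen k r gen_lab gen_u (inl i).
Proof.
rewrite /rt_gen; have -> : tdeg r gen_lab (inl i) = 0%MM.
  by apply/mnmP.
by rewrite mpolyX0 mulr1.
Qed.

Lemma col_exchange (c : colidx) (t : 'I_n) : (0 < col_u c t)%N ->
  exists q, exchange_col col_lab col_u (@Tvar k n r a) (Bmx k n a) c t q.
Proof.
move=> ct; pose z := Ordinal n_gt0.
have tc : (U_(t) <= col_u c)%MM by rewrite lep1mP -lt0n.
(* x_1 u / x_t is divisible by x_1, so it indexes a column of B, whose entries are then x_s u /
   x_t. *)
have [|c0 [tag0 u0]] := @col_surj (tag c) (col_u c - U_(t) + U_(z))%MM.
  have := congr1 mdeg (submK tc); rewrite !mdegD !mdeg1 => ->.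
  by rewrite mdeg_jmon.
have c0_col : c0 \in cols n a.
  rewrite mem_sort mem_filter mem_enum andbT.
  have := congr1 (fun m : 'X_{1..n} => m z) u0; rewrite mnmDE mnm1E eqxx mnmE /=.
  by rewrite -/(cj c0 1) -/(cj c0 0) subn0 addn1 => ->.
have [q qE] := seq_tnthP c0_col.
exists q => s; exists (clower c0 s.+1); split.
- by rewrite /col_lab /= tag0.
- apply: (@addIm _ U_(z)%MM).
  have lowE : (col_u (clower c0 s.+1) + U_(z) = col_u c0 + U_(s))%MM.
    apply: jmon_lower => //.
    by move: c0_col; rewrite mem_sort mem_filter => /andP[].
  rewrite -addmA [(U_(t) + _)%MM]addmC addmA lowE u0.
  by rewrite -(submK tc); apply/mnmP => x; rewrite !(mnmDE, mnmBE); lia.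
- by rewrite mxE -qE.
Qed.

Lemma col_exchange_all q :
  exists c t, exchange_col col_lab col_u (@Tvar k n r a) (Bmx k n a) c t q.
Proof.
pose c := tnth (in_tuple (cols n a)) q; exists c, (Ordinal n_gt0) => s.
exists (clower c s.+1); split=> //; last by rewrite mxE.
apply: jmon_lower => //; have := mem_tnth q (in_tuple (cols n a)).
by rewrite -/c mem_sort mem_filter => /andP[].
Qed.

Definition gen_var (v : 'I_n + colidx) : S :=
  match v with inl i => 'X_i | inr c => (Tvar k c)%:MP end.

Lemma exchange_col_Cmx c t q :
  exchange_col col_lab col_u (@Tvar k n r a) (Bmx k n a) c t q ->
  exchange_col gen_lab gen_u gen_var (Cmx k n a) (inr c) t (rshift 1 q).
Proof.
move=> cq s; have [c' [lc uc Bc]] := cq s; exists (inr c'); split=> //.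
by rewrite /Cmx row_mxEr mxE Bc.
Qed.

Lemma exchange_col_x t :
  exchange_col gen_lab gen_u gen_var (Cmx k n a) (inl t) t (lshift _ 0).
Proof.
move=> s; exists (inl s); split=> //; first exact: addmC.
by rewrite /Cmx row_mxEl mxE.
Qed.

Lemma gen_exchange_col v t : (0 < gen_u v t)%N ->
  exists q, exchange_col gen_lab gen_u gen_var (Cmx k n a) v t q.
Proof.
case: v => [i|c] /=.
  rewrite mnm1E; case: eqP => // -> _; exists (lshift _ 0).
  exact: exchange_col_x.
by move=> /col_exchange[q cq]; exists (rshift 1 q); apply: exchange_col_Cmx.
Qed.

Lemma gen_exchange_all q :
  exists v t, exchange_col gen_lab gen_u gen_var (Cmx k n a) v t q.
Proof.
rewrite -[q]splitK; case: (split q) => [q0|q1] /=.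
  rewrite ord1; exists (inl (Ordinal n_gt0)), (Ordinal n_gt0).
  exact: exchange_col_x.
have [c [t ct]] := col_exchange_all q1; exists (inr c), t.
exact: exchange_col_Cmx.
Qed.

Definition k_to_S : k -> S := @mpolyC n T \o @mpolyC #|{: colidx}| k.
HB.instance Definition _ := GRing.RMorphism.on k_to_S.

Lemma T_spanned (f : T) : spanned (@mpolyC #|{: colidx}| k) (@Tvar k n r a) f.
Proof.
apply: (@spanned_mpoly k T _ _ _ k _ idfun) => [b|i] /=; first exact: spanned_const.
by rewrite -[i]enum_valK; apply: spanned_gen.
Qed.

Lemma S_spanned (f : S) : spanned k_to_S gen_var f.
Proof.
apply: (@spanned_mpoly k S k_to_S _ gen_var T _ idfun) => [b|i] /=; last first.
  exact: (spanned_gen _ _ (inl i)).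
apply: (@spanned_mpoly k S k_to_S _ gen_var k _ (@mpolyC n T)) => [c|i].
  exact: (spanned_const _ _ c).
by rewrite -[i]enum_valK; apply: (spanned_gen _ _ (inr _)).
Qed.

Lemma fiber_spanned (x : fiber k n a) :
  spanned (k_to_fiber k n a) (fiber_xt k n a) x.
Proof.
pose v : {rmorphism fiber k n a -> Rt} := val.
apply: (@spanned_inj _ _ _ _ _ _ v (@k_to_Rt k n r) (@xt k n r a)) => //.
  exact: val_inj.
apply: (@subalg_gen_spanned k Rt (@k_to_Rt k n r) (@is_xt k n r a) k
  (@k_to_Rt k n r) _ (@xt k n r a) (v x)).
- exact: spanned_const.
- by move=> _ [c ->]; apply: spanned_gen.
- by apply/subalg_predP; apply: valP.
Qed.

Lemma rees_spanned (x : rees k n a) :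
  spanned (k_to_rees k n a) (rees_gens k n a) x.
Proof.
pose v : {rmorphism rees k n a -> Rt} := val.
apply: (@spanned_inj _ _ _ _ _ _ v (@k_to_Rt k n r) (v \o rees_gens k n a)) => //.
  exact: val_inj.
apply: (@subalg_gen_spanned R Rt (@mpolyC r R) (@is_xt k n r a) k
  (@k_to_Rt k n r) _ (v \o rees_gens k n a) (v x)).
- apply: (@spanned_mpoly k Rt (@k_to_Rt k n r) _ (v \o rees_gens k n a) k _
    (@mpolyC r R)) => [c|i].
    by rewrite -[_ c%:MP]/(@k_to_Rt k n r c); apply: spanned_const.
  by rewrite -[_ 'X_i]/((v \o rees_gens k n a) (inl i)); apply: spanned_gen.
- move=> _ [c ->]; rewrite -[xt k c]/((v \o rees_gens k n a) (inr c)).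
  exact: spanned_gen.
- by apply/subalg_predP; apply: valP.
Qed.

Theorem fiber_koszul_normal :
  [/\ koszul (k_to_fiber k n a) (fiber_xt k n a), normal_domain (fiber k n a),
      forall y : fiber k n a, exists f, psi k n a f = y
    & forall f, psi k n a f = 0 <-> minors_ideal 2 (Bmx k n a) f].
Proof.
pose v : {rmorphism fiber k n a -> Rt} := val.
have v_inj : injective v by apply: val_inj.
have v_iota c : v (k_to_fiber k n a c) = c%:MP%:MP by [].
have v_g i : v (fiber_xt k n a i) = rt_gen k r col_lab col_u i by apply: xt_col.
have psiC c : psi k n a c%:MP = k_to_fiber k n a c by rewrite /psi mmapC.
have psiT := @psi_T k n r a.
have mon_weq := rt_mon_weq (erefl : lab_deg 0 = 1%N) col_lab_ok
  col_u_mdeg v_inj v_iota v_g.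
split.
- exact: (monomial_algebra_koszul lab_deg_gt0 erefl col_lab_ok col_u_mdeg
    col_inj col_lab_surj v_inj v_iota v_g fiber_spanned).
- exact: (monomial_algebra_normal n_gt0 erefl col_lab_ok col_u_mdeg
    col_lab_surj v_inj v_iota v_g fiber_spanned).
- by move=> y; apply: (spanned_surj psiC psiT (fiber_spanned y)).
- move=> f; split; last first.
    exact: (minors2_kernel col_exchange_all psiT mon_weq).
  apply: (monomial_algebra_kernel erefl col_lab_ok col_u_mdeg
    col_inj col_lab_surj v_inj v_iota v_g psiC psiT T_spanned).
  + exact: ideal_gen0.
  + exact: ideal_genD.
  + exact: ideal_genM.
  + move=> i j i' j' s t; apply: minors2_exchange; first exact: col_inj.
    exact: col_exchange.
Qed.

Theorem rees_koszul_normal :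
  [/\ koszul (k_to_rees k n a) (rees_gens k n a), normal_domain (rees k n a),
      forall y : rees k n a, exists f, phi k n a f = y
    & forall f, phi k n a f = 0 <-> minors_ideal 2 (Cmx k n a) f].
Proof.
pose v : {rmorphism rees k n a -> Rt} := val.
have v_inj : injective v by apply: val_inj.
have v_iota c : v (k_to_rees k n a c) = c%:MP%:MP by [].
have v_g i : v (rees_gens k n a i) = rt_gen k r gen_lab gen_u i.
  by case: i => [i|c]; [apply: x_gen|apply: xt_gen].
have phiC c : phi k n a (k_to_S c) = k_to_rees k n a c.
  by rewrite /phi /k_to_S /= mmapC /= mmapC.
have phiT i : phi k n a (gen_var i) = rees_gens k n a i.
  by case: i => [i|c]; [apply: phi_X|apply: phi_T].
have mon_weq := rt_mon_weq (erefl : lab_deg 0 = 1%N) gen_lab_ok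
  gen_u_mdeg v_inj v_iota v_g.
split.
- exact: (monomial_algebra_koszul lab_deg_gt0 erefl gen_lab_ok gen_u_mdeg
    gen_inj gen_lab_surj v_inj v_iota v_g rees_spanned).
- exact: (monomial_algebra_normal n_gt0 erefl gen_lab_ok gen_u_mdeg
    gen_lab_surj v_inj v_iota v_g rees_spanned).
- move=> y; exact: (@spanned_surj k S k_to_S _ gen_var (rees k n a)
    (k_to_rees k n a) (rees_gens k n a) (phi k n a) y phiC phiT (rees_spanned y)).
- move=> f; split; last first.
    exact: (minors2_kernel gen_exchange_all phiT mon_weq).
  apply: (@monomial_algebra_kernel _ _ _ _ _ _ _ _ erefl gen_lab_ok gen_u_mdeg
    gen_inj gen_lab_surj (rees k n a) v (k_to_rees k n a) (rees_gens k n a)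
    v_inj v_iota v_g S k_to_S gen_var (phi k n a) (minors_ideal 2 (Cmx k n a))
    phiC phiT S_spanned).
  + exact: ideal_gen0.
  + exact: ideal_genD.
  + exact: ideal_genM.
  + move=> i j i' j' s t; apply: minors2_exchange; first exact: gen_inj.
    exact: gen_exchange_col.
Qed.

End Columns.

Unset Implicit Arguments.

Theorem theorem2p4 (k : fieldType) (n r : nat) (a : 'I_r -> nat)
    (n_gt0 : (0 < n)%N) (r_gt0 : (0 < r)%N)
    (a_gt0 : forall l, (1 <= a l)%N)
    (a_mono : forall l l' : 'I_r, (l <= l')%N -> (a l <= a l')%N) :
  [/\ koszul (k_to_rees k n a) (rees_gens k n a)
    & normal_domain (rees k n a)] /\
  [/\ koszul (k_to_fiber k n a) (fiber_xt k n a)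
    & normal_domain (fiber k n a)] /\
  [/\ forall y : rees k n a, exists f, phi k n a f = y
    & forall f, phi k n a f = 0 <-> minors_ideal 2 (Cmx k n a) f] /\
  [/\ forall y : fiber k n a, exists f, psi k n a f = y
    & forall f, psi k n a f = 0 <-> minors_ideal 2 (Bmx k n a) f].
Proof.
have [KR NR phi_surj ker_phi] := rees_koszul_normal k n_gt0 a_gt0.
have [KF NF psi_surj ker_psi] := fiber_koszul_normal k n_gt0 a_gt0.
exact: (conj (conj KR NR) (conj (conj KF NF)
  (conj (conj phi_surj ker_phi) (conj psi_surj ker_psi)))).
Qed.
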